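(* Let $\Omega$ be a finitely connected Jordan domain in $\mathbb{C}^*=\mathbb{C}\cup\{\infty\}$. Suppose $\Omega$ has a cusp with order of tangency $d>0$ and coefficient of tangency $a>0$ at a point $z_0\in\partial\Omega\cap\mathbb{C}$. Let $\mu$ be a non-negative measure of finite total mass on $\Omega$ such that $d\mu(z)=(1+o(1))|z-z_0|^{2b-2}d^2z$ as $z\to z_0$ for some $b>0$. Then the balayage $\nu:=\mathrm{Bal}(\mu,\partial\Omega)$ of $\mu$ onto $\partial\Omega$ satisfies, as $r\to0$, $$\nu(\partial\Omega\cap B_r(z_0))=(1+o(1))\frac{a}{2b+d}\,r^{2b+d}.$$ In particular, if (in place of the assumption that $d\mu(z)=(1+o(1))|z-z_0|^{2b-2}d^2z$ as $z\to z_0$, still with $b>0$) one has $d\mu(z)\asymp|z-z_0|^{2b-2}d^2z$ as $z\to z_0$, then $\nu(\partial\Omega\cap B_r(z_0))\asymp r^{2b+d}$ as $r\to0$.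
   Context: $B_r(z)\subset\mathbb{C}$ is the open disk of radius $r$ centered at $z$, and $d^2z=dx\,dy$ is Lebesgue measure. A finitely connected Jordan domain is an open connected subset of $\mathbb{C}^*$ whose boundary is a finite union of pairwise disjoint Jordan curves. Balayage: $\nu=\mathrm{Bal}(\mu,\partial\Omega)$ is the measure on $\partial\Omega$ given by $\nu(E)=\int_\Omega\omega(z,E,\Omega)\,d\mu(z)$ for Borel sets $E\subset\partial\Omega$, where $\omega(z,E,\Omega)$ is the harmonic measure of $E$ at $z$ in $\Omega$. It is assumed that $\omega(\cdot,E,\Omega)$ is $\mu$-measurable for every Borel $E\subset\partial\Omega$. Analytic cusp: a regular analytic arc is the image of a closed interval $I\subset\mathbb{R}$ under an analytic map $w:I\to\mathbb{C}^*$ with $w'\neq0$ on $I$. A finitely connected Jordan domain $\Omega$ has an analytic cusp at $z_0\in\partial\Omega\cap\mathbb{C}$ if near $z_0$ its boundary consists of two regular analytic arcs $C_\pm$ such that the interior angle of $\Omega$ at $z_0$ vanishes; i.e. there are $\epsilon>0$ and analytic functions $w_\pm:B_{2\epsilon}(0)\to\mathbb{C}$ with $w_\pm(0)=z_0$, $w_+'(0)=w_-'(0)\neq0$, such that $\partial\Omega$ near $z_0$ is $C_+\cup C_-$ with $C_\pm=w_\pm([0,\epsilon])$, where, with both arcs oriented outwards from $z_0$, $\Omega$ lies to the left of $C_+$ and to the right of $C_-$. After a rigid motion and reparametrization one may take $z_0=0$ and $w_\pm(r)=re^{i\theta_\pm(r)}$, $r\in[0,\epsilon]$, with $\theta_\pm$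 real analytic near $0$ and $\theta_\pm(0)=0$. For a power series $h(r)=\sum_{n\ge 0} h_nr^n$, $\mathrm{ord}(h)$ is the smallest $n$ with $h_n\ne0$ ($\mathrm{ord}(0)=\infty$). Write $\Theta(r)=\theta_+(r)-\theta_-(r)=\sum_{n\ge1}a_nr^n$. The order of tangency of the analytic cusp is the integer $d=\mathrm{ord}(\Theta)\ge1$ and its coefficient of tangency is $a_d$. The analytic cusp has small perturbation of angles if $\min\{\mathrm{ord}(\theta_+),\mathrm{ord}(\theta_-)\}=d$ and $a_{d+1}=\dots=a_{2d}=0$. Cusp: a finitely connected Jordan domain $\Omega$ has a cusp at $z_0\in\partial\Omega\cap\mathbb{C}$ if there are a radius $r>0$ and a $p>0$ such that $\varphi(z)=z_0+(z-z_0)^p$ is bijective from $\Omega\cap B_r(z_0)$ onto its image, and $\varphi(\Omega\cap B_r(z_0))$ has an analytic cusp at $z_0$ with small perturbation of angles. Then, if $r\Theta(r)$ denotes the length of $\Omega\cap\partial B_r(z_0)$, one has $\Theta(r)=ar^d+O(r^{2d+p})$ as $r\to0$ for some $a>0$, $d>0$; $d$ (a positive real number) is called the order of tangency and $a$ the coefficient of tangency of the cusp. Asymptotic notation for measures: $d\mu(z)=(1+o(1))|z-z_0|^{2b-2}d^2z$ as $z\to z_0$ means that for every $\epsilon>0$ there is $\rho_0>0$ such that $\big|\mu(A)-\int_A|z-z_0|^{2b-2}d^2z\big|\le\epsilon\int_A|z-z_0|^{2b-2}d^2z$ for all measurable $A\subset\Omega\cap B_{\rho_0}(z_0)$. $d\mu(z)\asymp|z-z_0|^{2b-2}d^2z$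 as $z\to z_0$ means that there are $\rho_0,c_1,c_2>0$ with $c_1\int_A|z-z_0|^{2b-2}d^2z\le\mu(A)\le c_2\int_A|z-z_0|^{2b-2}d^2z$ for all measurable $A\subset\Omega\cap B_{\rho_0}(z_0)$. For positive functions, $f(r)\asymp g(r)$ as $r\to0$ means that there are $r_0,c_1,c_2>0$ with $c_1g(r)\le f(r)\le c_2g(r)$ for $r\in(0,r_0)$. *)

(* Defs.v *)
From HB Require Import structures.
From mathcomp Require Import all_boot all_order all_algebra complex.
From mathcomp Require Import all_classical all_reals all_analysis.
From mathcomp Require Import measurable_realfun.
Import Order.TTheory GRing.Theory Num.Theory.
Import numFieldNormedType.Exports.

Set Implicit Arguments.
Unset Strict Implicit.
Unset Printing Implicit Defensive.

Local Open Scope classical_set_scope.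
Local Open Scope complex_scope.
Local Open Scope ring_scope.

Section Defs.
Context {R : realType}.

(* `R[i]` itself carries no canonical topology; its regular module does. *)
Definition cplx : normedModType R[i] := R[i]^o.

Definition cabs (z : cplx) : R := Normc.normc (z : R[i]).

Definition expi (t : R) : cplx := cos t +i* sin t.

Definition cdisk (z0 : cplx) (r : R) : set cplx := [set z | cabs (z - z0) < r].

(* The point at infinity is `None`. *)
Definition sphere : topologicalType := one_point_compactification cplx.

Definition sdisk (z0 : cplx) (r : R) : set sphere := Some @` cdisk z0 r.

Definition sphere_borel := g_sigma_algebraType (@open sphere).

Definition frontier (T : topologicalType) (A : set T) : set T :=
  closure A `\` interior A.

Definition jordan_curve (J : set sphere) : Prop :=
  exists g : R -> sphere,
    [/\ {within `[0, 1], continuous g}, g 0 = g 1,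
        {in `[0, 1[ &, injective g} & J = g @` `[0, 1]].

Definition finitely_connected_jordan_domain (Omega : set sphere) : Prop :=
  [/\ open Omega, connected Omega &
      exists (n : nat) (J : 'I_n -> set sphere),
        [/\ forall i, jordan_curve (J i),
            forall i j, i != j -> J i `&` J j = set0 &
            frontier Omega = \bigcup_i J i]].

(* Harmonic measure is defined as the representing measure of the Perron
   solution of the Dirichlet problem with continuous boundary data.  Local
   submean inequality at infinity is taken in the chart z |-> 1/z. *)

Definition small_circle (x : sphere) (r t : R) : sphere :=
  if x is Some w then Some ((w : R[i]) + r%:C * expi t)
  else Some ((r%:C * expi t)^-1).

Definition subharmonic (Omega : set sphere) (u : sphere -> \bar R) : Prop :=
  forall x, Omega x ->
    [/\ (u x < +oo)%E,
        forall c : \bar R, (u x < c)%E -> \forall y \near x, (u y < c)%E &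
        \forall r \near 0^'+,
          (u x <= ((2 * pi)^-1)%:E *
            \int[@lebesgue_measure R]_(t in `[0%R, (2 * pi : R)%R])
              u (small_circle x r t))%E].

Definition perron_family (Omega : set sphere) (phi : sphere -> R) :
    set (sphere -> \bar R) :=
  [set u | subharmonic Omega u /\
    forall zeta, frontier Omega zeta ->
      (limf_esup u (within Omega (nbhs zeta)) <= (phi zeta)%:E)%E].

Definition perron (Omega : set sphere) (phi : sphere -> R) (z : sphere) :
    \bar R :=
  ereal_sup [set u z | u in perron_family Omega phi].

(* omega z E is the harmonic measure of E at z in Omega.  Its values at points
   z outside Omega are irrelevant. *)
Definition is_harmonic_measure (Omega : set sphere)
    (omega : sphere -> probability sphere_borel R) : Prop :=
  forall z, Omega z ->
    omega z (frontier Omega) = 1%E /\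
    forall phi : sphere -> R, {within frontier Omega, continuous phi} ->
      (\int[omega z]_(x in frontier Omega) (phi x)%:E = perron Omega phi z)%E.

Definition balayage (Omega : set sphere)
    (omega : sphere -> probability sphere_borel R)
    (mu : {measure set sphere_borel -> \bar R}) (E : set sphere) : \bar R :=
  (\int[mu]_(z in Omega) omega z E)%E.

Definition balayage_defined (Omega : set sphere)
    (omega : sphere -> probability sphere_borel R) : Prop :=
  forall E : set sphere_borel, measurable E -> E `<=` frontier Omega ->
    measurable_fun (Omega : set sphere_borel)
      ((fun z => omega z E) : sphere_borel -> \bar R).

Definition regular_analytic_param (e : R) (w : cplx -> cplx) : Prop :=
  (forall z, cdisk 0 (2 * e) z -> derivable w z 1) /\
  (forall t, t \in `[0, e] -> derive1 w (t%:C : R[i]) != 0).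

Definition param_arc (e : R) (w : cplx -> cplx) : set cplx :=
  [set w (t%:C : R[i]) | t in `[0, e]].

(* Point with polar coordinates (r, t) relative to the pole z0 and to the
   axis of direction u. *)
Definition polar_point (z0 u : cplx) (r t : R) : cplx :=
  (z0 : R[i]) + u * (r%:C * expi t).

(* The set U has an analytic cusp at z0 whose bounding arcs C+ and C- are, after
   a rigid motion mapping z0 to 0 and the unit direction u to 1, given near 0 by
   r |-> r * exp(i * thp r) and r |-> r * exp(i * thm r).  The notion is local at
   z0.  The arcs are labelled so that U is swept counterclockwise from C- to C+,
   i.e. thp - thm is the positive angular width of U. *)
Definition analytic_cusp (U : set cplx) (z0 : cplx) (thp thm : R -> R) : Prop :=
  [/\ thp 0 = 0, thm 0 = 0 &
  exists (e : R) (wp wm : cplx -> cplx),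
    [/\ 0 < e,
        regular_analytic_param e wp /\ regular_analytic_param e wm,
        wp 0 = z0 /\ wm 0 = z0,
        derive1 wp 0 = derive1 wm 0 &
        exists (u : cplx) (delta : R),
        [/\ cabs u = 1, 0 < delta,
            frontier U `&` cdisk z0 delta =
              (param_arc e wp `|` param_arc e wm) `&` cdisk z0 delta,
            param_arc e wp `&` cdisk z0 delta =
              [set polar_point z0 u r (thp r) | r in `[0, delta[] /\
            param_arc e wm `&` cdisk z0 delta =
              [set polar_point z0 u r (thm r) | r in `[0, delta[] &
            U `&` cdisk z0 delta =
              [set z | exists r t, [/\ 0 < r < delta, thm r < t < thp r &
                                       z = polar_point z0 u r t]]]]].

Definition power_expansion (c : nat -> R) (h : R -> R) : Prop :=
  \forall r \near (0 : R), pseries c r @ \oo --> h r.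

(* Order of a power series, as an extended real; it is +oo for the series 0. *)
Definition ord (c : nat -> R) : \bar R :=
  ereal_inf [set (n%:R)%:E | n in [set n | c n != 0]].

Definition analytic_cusp_small_perturbation (U : set cplx) (z0 : cplx) : Prop :=
  exists (thp thm : R -> R) (cp cm : nat -> R) (d : nat),
    let a n := cp n - cm n in
    [/\ analytic_cusp U z0 thp thm,
        power_expansion cp thp /\ power_expansion cm thm,
        ord a = (d%:R)%:E,
        Order.min (ord cp) (ord cm) = (d%:R)%:E &
        forall n, (d < n <= d.*2)%N -> a n = 0].

(* tau is a continuous branch of arg(z - z0) on V. *)
Definition arg_branch (V : set cplx) (z0 : cplx) (tau : cplx -> R) : Prop :=
  {within V, continuous tau} /\
  forall z, V z -> z = polar_point z0 1 (cabs (z - z0)) (tau z).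

(* z |-> z0 + (z - z0)^p for the branch of the power determined by tau. *)
Definition power_map (z0 : cplx) (p : R) (tau : cplx -> R) (z : cplx) : cplx :=
  polar_point z0 1 (cabs (z - z0) `^ p) (p * tau z).

Definition has_cusp_exponent (Omega : set sphere) (z0 : cplx) (p : R) : Prop :=
  [/\ frontier Omega (Some z0), 0 < p &
  exists (r : R) (tau : cplx -> R),
    let V := [set z : cplx | Omega (Some z)] `&` cdisk z0 r in
    let W := power_map z0 p tau @` V in
    [/\ 0 < r, arg_branch V z0 tau, set_bij V W (power_map z0 p tau) &
        analytic_cusp_small_perturbation W z0]].

(* Angular measure of Omega on the circle of radius r centered at z0: the length
   of the part of this circle lying in Omega is r * angular_width Omega z0 r. *)
Definition angular_width (Omega : set sphere) (z0 : cplx) (r : R) : R :=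
  fine (lebesgue_measure
    [set t : R | 0 <= t < 2 * pi /\ Omega (Some (polar_point z0 1 r t))]).

Definition has_cusp (Omega : set sphere) (z0 : cplx) (d a : R) : Prop :=
  [/\ 0 < d, 0 < a &
  exists p : R, has_cusp_exponent Omega z0 p /\
    exists K : R, \forall r \near 0^'+,
      `|angular_width Omega z0 r - a * r `^ d| <= K * r `^ (2 * d + p)].

(* The integral of |z - z0|^(2b-2) d^2z over A, the plane being R * R. *)
Definition power_weight (z0 : cplx) (b : R) (A : set sphere) : \bar R :=
  (\int[(@lebesgue_measure R \x @lebesgue_measure R)%E]_(q in
      (fun q : R * R => Some (q.1 +i* q.2 : cplx)) @^-1` A)
    (cabs ((q.1 +i* q.2 : cplx) - z0) `^ (2 * b - 2))%:E)%E.

Definition sim_power_weight (Omega : set sphere)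
    (mu : {measure set sphere_borel -> \bar R}) (z0 : cplx) (b : R) : Prop :=
  forall eps : R, 0 < eps -> exists2 rho : R, 0 < rho &
    forall A : set sphere_borel, measurable A ->
      A `<=` Omega `&` sdisk z0 rho ->
      (`|mu A - power_weight z0 b A| <= eps%:E * power_weight z0 b A)%E.

Definition asymp_power_weight (Omega : set sphere)
    (mu : {measure set sphere_borel -> \bar R}) (z0 : cplx) (b : R) : Prop :=
  exists rho c1 c2 : R, [/\ 0 < rho, 0 < c1, 0 < c2 &
    forall A : set sphere_borel, measurable A ->
      A `<=` Omega `&` sdisk z0 rho ->
      (c1%:E * power_weight z0 b A <= mu A <= c2%:E * power_weight z0 b A)%E].

End Defs.

Arguments cplx : clear implicits.
Arguments sphere : clear implicits.
Arguments sphere_borel : clear implicits.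

(* Main.v *)
From HB Require Import structures.
Require Import Defs.
From mathcomp Require Import all_boot all_order all_algebra complex.
From mathcomp Require Import all_classical all_reals all_analysis.
From mathcomp Require Import measurable_realfun.
From mathcomp Require Import ring lra.
Import Order.TTheory GRing.Theory Num.Theory.
Import numFieldNormedType.Exports.

Set Implicit Arguments.
Unset Strict Implicit.
Unset Printing Implicit Defensive.

Local Open Scope classical_set_scope.
Local Open Scope ring_scope.

(** The balayage of the ball of radius [r] about the cusp [z0] is the integral
    against [mu] of the harmonic measure of [frontier Omega] inside that ball.
    Near [z0] the domain is a strip whose width at distance [r] from [z0] is of
    order [r `^ (1 + p)], far less than [r].  A subharmonic function that is
    nonpositive on the sides of a strip is halved each time one moves a fixed
    multiple of the width into the strip.  A stretch of length [e * r] has room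
    for a number [k] of such moves of order [r `^ - p], and [2 ^- k] is then
    smaller than every power of [r].  So the harmonic measure of the ball seen
    from a point [z] is nearly 1 when [z] is closer to [z0] than
    [r * (1 - 2 * e)], and nearly 0 when it is farther than [r * (1 + 2 * e)].
    This squeezes the balayage of the ball between the masses that [mu] gives
    to two slightly different balls ([balayage_sandwich]).

    The rest is the mass of the weight.  In polar coordinates
    ([power_weight_polar]) the ball of radius [s] has weight the integral of
    [r `^ (2 * b - 1)] times the angular width of the domain at [r], and this
    width is equivalent to [a * r `^ d]; hence the mass is equivalent to
    [a / (2 * b + d) * s `^ (2 * b + d)] ([power_weight_bounds]).  Letting [e]
    tend to 0 gives the asymptotic equivalence, and a fixed [e] the two-sided
    bound.

    Harmonic measure is known through Perron families only.  A continuous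
    function that dominates the indicator of a boundary set bounds its harmonic
    measure by the Perron solution, so one has to bound each member of the Perron
    family.  Such members are subharmonic, at most 1, and asymptotically
    nonpositive where the boundary data vanish.  They are compared with strictly
    superharmonic functions by a maximum principle ([comparison]), whose
    compactness argument takes place on the whole sphere.  Two explicit barriers
    suffice: a quadratic polynomial, which proves the halving in a strip
    ([strip_halving], [strip_decay]), and a multiple of [- |z - z0| ^- 2], which
    carries a bound on a ring about [z0] to the whole of the domain beyond the
    ring, infinity included ([outer_decay]).  That a cusp is a strip is
    [cusp_strip]. *)

(** * The plane and the sphere *)

Section Plane.
Context {R : realType}.
Implicit Types z w : cplx R.

Definition Cx (x y : R) : cplx R := (x +i* y)%C.
Definition Rep (z : cplx R) : R := complex.Re z.
Definition Imp (z : cplx R) : R := complex.Im z.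

Lemma CxE z : z = Cx (Rep z) (Imp z). Proof. by case: z. Qed.
Lemma CxD x y x' y' : Cx x y + Cx x' y' = Cx (x + x') (y + y'). Proof. by []. Qed.
Lemma CxN x y : - Cx x y = Cx (- x) (- y). Proof. by []. Qed.
Lemma CxB x y x' y' : Cx x y - Cx x' y' = Cx (x - x') (y - y'). Proof. by []. Qed.

Lemma RepCx x y : Rep (Cx x y) = x. Proof. by []. Qed.
Lemma ImpCx x y : Imp (Cx x y) = y. Proof. by []. Qed.

Lemma cabsCx x y : cabs (Cx x y) = Num.sqrt (x ^+ 2 + y ^+ 2).
Proof. by []. Qed.
Lemma cabs_ge0 z : 0 <= cabs z.
Proof. by rewrite (CxE z) cabsCx sqrtr_ge0. Qed.
Lemma cabs_sqr x y : cabs (Cx x y) ^+ 2 = x ^+ 2 + y ^+ 2.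
Proof. by rewrite cabsCx sqr_sqrtr// addr_ge0// sqr_ge0. Qed.
Lemma cabsD z w : cabs (z + w) <= cabs z + cabs w.
Proof. exact: (@le_normcD R z w). Qed.
Lemma cabsN z : cabs (- z) = cabs z.
Proof. by rewrite (CxE z) CxN !cabsCx !sqrrN. Qed.
Lemma cabsBC z w : cabs (z - w) = cabs (w - z).
Proof. by rewrite -cabsN opprB. Qed.
Lemma cabs_tri z w z' : cabs (z - w) <= cabs (z - z') + cabs (z' - w).
Proof. by apply: le_trans (cabsD _ _); rewrite addrA subrK. Qed.
Lemma cabsM z w : cabs ((z : R[i]) * w) = cabs z * cabs w.
Proof. exact: Normc.normcM. Qed.
Lemma cabs0 : cabs (0 : cplx R) = 0. Proof. exact: Normc.normc0. Qed.
Lemma cabs_eq0 z : cabs z = 0 -> z = 0. Proof. exact: Normc.eq0_normc. Qed.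
Lemma cabs_expi t : cabs (@expi R t) = 1.
Proof.
by rewrite -[expi t]/(Cx (cos t) (sin t)) cabsCx cos2Dsin2 sqrtr1.
Qed.
Lemma cabs_real x : cabs (x%:C%C : cplx R) = `|x|.
Proof. by rewrite -[x%:C%C]/(Cx x 0) cabsCx expr0n addr0 sqrtr_sqr. Qed.
Lemma Rep_le z : `|Rep z| <= cabs z.
Proof.
by rewrite {2}(CxE z) cabsCx -sqrtr_sqr ler_wsqrtr// lerDl sqr_ge0.
Qed.
Lemma Imp_le z : `|Imp z| <= cabs z.
Proof.
by rewrite {2}(CxE z) cabsCx -sqrtr_sqr ler_wsqrtr// lerDr sqr_ge0.
Qed.
Lemma cabs_le x y : cabs (Cx x y) <= `|x| + `|y|.
Proof.
have -> : Cx x y = Cx x 0 + Cx 0 y by rewrite CxD addr0 add0r.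
apply: le_trans (cabsD _ _) _.
by rewrite !cabsCx expr0n addr0 add0r !sqrtr_sqr.
Qed.

(** The norm of [cplx R] takes its values in [R[i]], so that the radii of its
    balls are complex numbers; this is the passage to real radii. *)
Lemma nbhs_cplxP z (A : set (cplx R)) :
  nbhs z A <-> exists2 e : R, 0 < e & forall w, cabs (w - z) < e -> A w.
Proof.
split.
  move=> /nbhs_ballP[e /= e0 eA].
  have [e1 e2] : complex.Im e = 0 /\ 0 < complex.Re e.
    by move: e0; rewrite ltcE /= => /andP[/eqP -> ->].
  exists (complex.Re e) => // w wz; apply: eA => /=.
  rewrite -ball_normE /= distrC -[`|_|]/((cabs (w - z))%:C%C).
  have -> : e = (complex.Re e)%:C%C by case: {e0 e2 wz} e e1 => a b /= ->.
  by rewrite ltcR.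
move=> [e e0 eA]; apply/nbhs_ballP; exists (e%:C%C : R[i]) => /=.
  by rewrite ltcR.
move=> w; rewrite -ball_normE /= distrC -[`|_|]/((cabs (w - z))%:C%C) ltcR.
exact: eA.
Qed.

Lemma open_cdisk (z0 : cplx R) r : open (cdisk z0 r).
Proof.
rewrite openE => z zr; apply/nbhs_cplxP.
exists (r - cabs (z - z0)); first by rewrite subr_gt0.
move=> w wz; rewrite /cdisk /=.
by apply: le_lt_trans (cabs_tri _ _ z) _; rewrite -ltrBrDr.
Qed.

Lemma continuous_cabs : continuous (@cabs R : cplx R -> R).
Proof.
move=> z A /nbhs_ballP[e /= e0 eA]; apply/nbhs_cplxP; exists e => // w wz.
apply: eA; rewrite /ball /= ltr_norml; have := cabsD (z - w) w; have := cabsD (w - z) z.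
by rewrite (cabsBC z w) !subrK; lra.
Qed.

Lemma continuous_Cx : continuous (fun q : R * R => Cx q.1 q.2).
Proof.
move=> [x y] A /nbhs_cplxP[e e0 eA]; apply/nbhs_ballP.
exists (e / 2) => /=; first by rewrite divr_gt0.
move=> [x' y'] /= [xx yy]; apply: eA; rewrite CxB.
apply: le_lt_trans (cabs_le _ _) _.
move: xx yy; rewrite /ball /= (distrC x) (distrC y); lra.
Qed.

Lemma compact_closed_disk (M : R) : compact [set z : cplx R | cabs z <= M].
Proof.
have cK : compact (`[-M, M] `*` `[-M, M] : set (R * R)).
  by apply: compact_setX; exact: segment_compact.
have := continuous_compact (continuous_subspaceT continuous_Cx) cK.
move=> h; apply: (subclosed_compact _ h).
  have -> : [set z : cplx R | cabs z <= M] = @cabs R @^-1` [set x : R | x <= M].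
    by [].
  by apply: closed_comp; [move=> ? _; exact: continuous_cabs|exact: closed_le].
move=> z /= zM; exists (Rep z, Imp z); last by rewrite -CxE.
have := Rep_le z; have := Imp_le z; rewrite !ler_norml => /andP[? ?] /andP[? ?].
by split; rewrite /= in_itv /=; lra.
Qed.

End Plane.

Section Sphere.
Context {R : realType}.
Implicit Types z w : cplx R.

Lemma nbhs_SomeP z (A : set (sphere R)) :
  nbhs (Some z : sphere R) A <->
  exists2 e : R, 0 < e & forall w, cabs (w - z) < e -> A (Some w).
Proof. exact: nbhs_cplxP. Qed.

(** Neighbourhoods of infinity are the complements of closed compact sets:
    these are bounded, and conversely closed disks are compact. *)
Lemma nbhs_NoneP (A : set (sphere R)) :
  nbhs (None : sphere R) A <->
  A None /\ exists M : R, forall w, M < cabs w -> A (Some w).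
Proof.
split.
  move=> [K [cK clK] KA]; split; first by apply: KA; right.
  have : compact (@cabs R @` K).
    by apply: continuous_compact => //; exact: (continuous_subspaceT continuous_cabs).
  move=> /compact_bounded[M0 [_ /(_ (M0 + 1))]] H.
  exists (M0 + 1) => w wM; apply: KA; left; exists w => // Kw.
  have := H _ (cabs w) (ex_intro2 _ _ w Kw erefl).
  rewrite ltrDl ltr01 => /(_ isT) /=.
  by rewrite ger0_norm ?cabs_ge0//; lra.
move=> [AN [M MA]]; exists [set w | cabs w <= M].
  split; first exact: compact_closed_disk.
  have -> : [set z : cplx R | cabs z <= M] = @cabs R @^-1` [set x : R | x <= M].
    by [].
  by apply: closed_comp; [move=> ? _; exact: continuous_cabs|exact: closed_le].
move=> [w|] [] //= [w' /negP]; rewrite -ltNge => h [<-]; exact: MA.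
Qed.

Lemma sphere_compact : compact [set: sphere R].
Proof. exact: one_point_compactification_compact. Qed.

Lemma open_sdisk (z0 : cplx R) (r : R) : open (sdisk z0 r).
Proof. apply: one_point_compactification_open_some; exact: open_cdisk. Qed.

Lemma frontier_open (Omega : set (sphere R)) :
  open Omega -> frontier Omega = closure Omega `\` Omega.
Proof. by move=> oO; rewrite /frontier (interior_id Omega).1. Qed.

(** The form in which the boundary condition of a Perron family is used. *)
Lemma limf_esup_within_lt (Omega : set (sphere R)) (u : sphere R -> \bar R)
    (x : sphere R) (c : \bar R) :
  (@limf_esup (sphere R) (sphere R) R u (within Omega (nbhs x)) < c)%E ->
  \forall y \near x, Omega y -> (u y < c)%E.
Proof.
rewrite limf_esupE => /ereal_inf_lt[_ [A /= AF <-]] Ac.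
have AF' : \forall y \near x, Omega y -> A y by exact: AF.
apply: filterS AF' => y Ay Oy; apply: (le_lt_trans _ Ac).
by apply: ereal_sup_ubound; exists y => //; exact: Ay.
Qed.

End Sphere.

(** * Circle means and the comparison principle *)

Section CircleMeans.
Context {R : realType}.
Local Notation mu := (@lebesgue_measure R).

(** The integral of a nonnegative function is a supremum over the simple
    functions below it, so monotonicity holds without measurability. This
    matters because a subharmonic function is only semicontinuous, and only
    inside the domain. *)
Lemma le_integral_pointwise d (T : measurableType d)
    (m : {measure set T -> \bar R}) (D : set T) (f g : T -> \bar R) :
  (forall x, D x -> (f x <= g x)%E) ->
  (\int[m]_(x in D) f x <= \int[m]_(x in D) g x)%E.
Proof.
move=> fg.
have fgD x : ((f \_ D) x <= (g \_ D) x)%E.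
  by rewrite /patch; case: ifPn => // /set_mem; exact: fg.
rewrite /integral; apply: leeB; apply: ge_ereal_sup => _ [h /= hf <-];
  apply: ereal_sup_ubound; exists h => //= x; apply: le_trans (hf x) _.
  by rewrite !funeposE ge_max !le_max lexx orbT andbT fgD.
by rewrite !funenegE ge_max !le_max lexx orbT andbT leeN2 fgD.
Qed.

(** The restriction of a quadratic polynomial of the plane to a circle has
    this form; the barriers are bounded by such functions on small circles. *)
Lemma integral_trig2 (A B C D E : R) :
  (\int[mu]_(t in `[0%R, (2 * pi)%R])
     (A + B * cos t + C * sin t + D * cos t ^+ 2 + E * (sin t * cos t))%:E
   = (2 * pi * A + pi * D)%:E)%E.
Proof.
pose f := fun t : R => A + B * cos t + C * sin t + D * cos t ^+ 2
  + E * (sin t * cos t).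
pose F : R -> R := A *: id + B *: sin + (- C) *: cos + (D / 2) *: (id + sin * cos)
  + (E / 2) *: (sin * sin).
have dF (t : R) : is_derive t (1 : R) F (f t).
  have d1 := @is_derive_sin R t. have d2 := @is_derive_cos R t.
  have d0 := @is_derive_id R R t 1.
  have dss := is_deriveM d1 d1. have dsc := is_deriveM d1 d2.
  have := is_deriveD (is_deriveD (is_deriveD (is_deriveD (is_deriveZ A d0)
    (is_deriveZ B d1)) (is_deriveZ (- C) d2)) (is_deriveZ (D / 2)
    (is_deriveD d0 dsc))) (is_deriveZ (E / 2) dss).
  have -> : A%:A + B *: cos t + - C *: - sin t +
       (D / 2) *: (1 + (sin t *: - sin t + cos t *: cos t)) +
       (E / 2) *: (sin t *: cos t + sin t *: cos t) = f t :> R; last by [].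
  rewrite /f /GRing.scale /=; move: (cos2Dsin2 t).
  move: (cos t) (sin t) => c s h.
  have -> : 1 + (s * - s + c * c) = 2 * c ^+ 2 by rewrite -[X in X + _]h; ring.
  by field.
have cf : continuous f.
  have cc := @continuous_cos R. have cs := @continuous_sin R.
  move=> t; apply: cvgD; [apply: cvgD; [apply: cvgD; [apply: cvgD|]|]|].
  - exact: cvg_cst.
  - by apply: cvgM; [exact: cvg_cst|exact: cc].
  - by apply: cvgM; [exact: cvg_cst|exact: cs].
  - by apply: cvgM; [exact: cvg_cst|apply: cvgM; exact: cc].
  - by apply: cvgM; [exact: cvg_cst|apply: cvgM; [exact: cs|exact: cc]].
have pi0 := pi_gt0 R.
have sin2 : sin (2 * pi) = 0 :> R by rewrite mulr_natl sin2pi.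
have cos2 : cos (2 * pi) = 1 :> R by rewrite mulr_natl cos2pi.
have ab : (0 : R) < 2 * pi by rewrite mulr_gt0.
rewrite (@continuous_FTC2 _ f F 0 (2 * pi) ab).
- have FE t : F t = A * t + B * sin t + - C * cos t + D / 2 * (t + sin t * cos t)
      + E / 2 * (sin t * sin t) by [].
  rewrite !FE sin2 cos2 cos0 sin0 -EFinB; congr EFin.
  by field.
- by apply: continuous_subspaceT => x; exact: cf.
- split.
  + by move=> x _; apply: ex_derive.
  + apply: cvg_at_right_filter; apply: differentiable_continuous.
    by apply/derivable1_diffP; apply: ex_derive.
  + apply: cvg_at_left_filter; apply: differentiable_continuous.
    by apply/derivable1_diffP; apply: ex_derive.
- by move=> x _; rewrite derive1E; apply: derive_val.
Qed.

(** The inequality is required of every shift [v + m], because the comparison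
    principle applies it at the shift at which [u] would touch [v + m]; for
    integrals of functions that are not known to be integrable, the shifts do
    not follow from one another. *)
Definition strict_supermean (v : sphere R -> R) (x : sphere R) (r : R) :=
  forall m : R, (((2 * pi)^-1)%:E *
    (\int[mu]_(t in `[0%R, (2 * pi)%R]) (v (small_circle x r t) + m)%:E) <
    (v x + m)%:E)%E.

Lemma strict_supermean_trig (v : sphere R -> R) x r (A B C D E : R) :
  (forall t, v (small_circle x r t) <=
     A + B * cos t + C * sin t + D * cos t ^+ 2 + E * (sin t * cos t)) ->
  A + D / 2 < v x -> strict_supermean v x r.
Proof.
move=> vle Av m.
have pi0 := pi_gt0 R.
have pi20 : 0 < (2 * pi)^-1 :> R by rewrite invr_gt0 mulr_gt0.
have : (\int[mu]_(t in `[0%R, (2 * pi)%R]) (v (small_circle x r t) + m)%:E <=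
  \int[mu]_(t in `[0%R, (2 * pi)%R])
    ((A + m) + B * cos t + C * sin t + D * cos t ^+ 2 + E * (sin t * cos t))%:E)%E.
  by apply: le_integral_pointwise => t _; rewrite lee_fin; have := vle t; lra.
rewrite integral_trig2 => h.
apply: (@le_lt_trans _ _ (((2 * pi)^-1)%:E * (2 * pi * (A + m) + pi * D)%:E)%E).
  by apply: lee_wpmul2l => //; rewrite lee_fin ltW.
rewrite -EFinM lte_fin.
have gen (p : R) : 0 < p -> (2 * p)^-1 * (2 * p * (A + m) + p * D) = A + m + D / 2.
  by move=> p0; field; rewrite gt_eqF.
by rewrite (gen _ pi0); lra.
Qed.

Lemma small_circle_near (U : set (sphere R)) x : open U -> U x ->
  \forall r \near (0 : R)^'+, forall t, U (small_circle x r t).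
Proof.
move=> oU Ux; have {oU Ux} : nbhs x U by exact: open_nbhs_nbhs.
case: x => [w|].
  move=> /nbhs_SomeP[e e0 eU]; near=> r => t; apply: eU.
  rewrite addrAC subrr add0r cabsM cabs_expi mulr1 cabs_real gtr0_norm//.
move=> /nbhs_NoneP[_ [M MU]]; near=> r => t; apply: MU.
have r0 : 0 < r by [].
rewrite /cabs Normc.normcV -/(cabs _) cabsM cabs_expi mulr1 cabs_real gtr0_norm//.
have : r < (`|M| + 1)^-1 by near: r; apply: nbhs_right_lt; rewrite invr_gt0 ltr_pwDr.
rewrite -ltf_pV2 ?posrE ?invr_gt0 ?ltr_pwDr// invrK.
have := ler_norm M; lra.
Unshelve. all: by end_near. Qed.

End CircleMeans.

Section Comparison.
Context {R : realType}.
Local Notation mu := (@lebesgue_measure R).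

(** A maximum principle. Suppose that [m], the supremum of [u - v] on [U], is
    positive. At a point of [U] where [u = v + m], the submean inequality of
    [u] on a small circle contradicts the strict supermean inequality of [v +
    m]. Hence [u < v + m] on [U], and by semicontinuity each point of the
    sphere has a neighbourhood on which [u <= v + c] for some [c < m]; outside
    [U] this is the boundary condition. By compactness of the sphere a single
    [c < m] serves everywhere, against the choice of [m]. *)
Lemma comparison (Omega U : set (sphere R)) (u : sphere R -> \bar R)
    (v : sphere R -> R) (K : R) :
  subharmonic Omega u -> U `<=` Omega -> open U ->
  (forall x, U x -> (u x <= (v x + K)%:E)%E) ->
  (forall x, U x -> forall e, 0 < e -> \forall y \near x, v x - e < v y) ->
  (forall x, U x -> \forall r \near (0 : R)^'+, strict_supermean v x r) ->
  (forall x, ~ U x -> forall c, 0 < c ->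
     \forall y \near x, U y -> (u y <= (v y + c)%:E)%E) ->
  forall x, U x -> (u x <= (v x)%:E)%E.
Proof.
move=> su UO oU uK vlsc vsup bd x0 Ux0.
rewrite leNgt; apply/negP => x0lt.
pose S := [set c : R | exists2 x, U x & ((v x + c)%:E <= u x)%E].
have SK : ubound S K.
  move=> c [x Ux cx]; have := le_trans cx (uK x Ux).
  by rewrite lee_fin lerD2l.
have [c0 c00 Sc0] : exists2 c : R, 0 < c & S c.
  have [H1 _ _] := su _ (UO _ Ux0).
  move: x0lt H1; case E : (u x0) => [a| |] //; rewrite lte_fin => va _.
  exists (a - v x0); first by rewrite subr_gt0.
  by exists x0 => //; rewrite E lee_fin; lra.
have supS : has_sup S by split; [exists c0|exists K].
pose m := sup S.
have m0 : 0 < m by apply: lt_le_trans c00 _; exact: (sup_upper_bound supS).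
have ltm x : U x -> (u x <= (v x + m)%:E)%E.
  move=> Ux; have [H1 _ _] := su _ (UO _ Ux).
  move: H1; case E : (u x) => [a| |] // _; last by rewrite leNye.
  rewrite lee_fin -lerBlDl; apply: (sup_upper_bound supS).
  by exists x => //; rewrite E lee_fin; lra.
(* a neighbourhood of [x] times a left neighbourhood of [m]: the form in which
   compactness gives one [c] for all points *)
have key x : [set: sphere R] x ->
    \forall x' \near x & c \near m^'-, U x' -> (u x' <= (v x' + c)%:E)%E.
  move=> _.
  suff [c cm near_c] : exists2 c, c < m &
      \forall y \near x, U y -> (u y <= (v y + c)%:E)%E.
    exists ([set y | U y -> (u y <= (v y + c)%:E)%E], [set c' | c < c']).
      by split => //=; exact: nbhs_left_gt.
    move=> [y c'] /= [h cc'] Uy; apply: le_trans (h Uy) _.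
    by rewrite lee_fin lerD2l ltW.
  have [Ux|nUx] := pselect (U x); last first.
    by exists (m / 2); [lra|apply: bd => //; lra].
  have [H1 H2 H3] := su _ (UO _ Ux).
  (* [u] cannot touch [v + m]: look at a small circle around [x] *)
  have : (u x < (v x + m)%:E)%E.
    rewrite ltNge; apply/negP => mx.
    have [r [cU ur vr]] : exists r, [/\ forall t, U (small_circle x r t),
        (u x <= ((2 * pi)^-1)%:E *
            \int[@lebesgue_measure R]_(t in `[0%R, (2 * pi : R)%R])
              u (small_circle x r t))%E & strict_supermean v x r].
      apply: (@filter_ex _ ((0 : R)^'+)).
      have h1 := small_circle_near oU Ux.
      have h2 := vsup _ Ux.
      by near=> r; split; near: r.
    have := vr m; rewrite ltNge => /negP; apply.
    apply: le_trans mx _; apply: le_trans ur _.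
    apply: lee_wpmul2l; first by rewrite lee_fin invr_ge0 mulr_ge0// pi_ge0.
    by apply: le_integral_pointwise => t _; exact: ltm.
  move=> uxm.
  have [c [cm uc]] : exists c : R, c < m /\ (u x < (v x + c)%:E)%E.
    move: H1 uxm; case E : (u x) => [a| |] // _.
      by rewrite !lte_fin => am; exists ((a - v x + m) / 2); rewrite lte_fin; lra.
    by move=> _; exists 0; split => //; rewrite ltNyr.
  exists ((c + m) / 2); first lra.
  have e0 : 0 < (m - c) / 2 by lra.
  have := vlsc _ Ux _ e0; have := H2 _ uc.
  apply: filterS2 => y uy vy _; apply: le_trans (ltW uy) _.
  by rewrite lee_fin; lra.
have /compact_near_coveringP := @sphere_compact R.
move=> /(_ R (m^'-) (fun c x' => U x' -> (u x' <= (v x' + c)%:E)%E)).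
move=> /(_ _ key) near_m.
have [c [cm hc]] : exists c, c < m /\ forall x, U x -> (u x <= (v x + c)%:E)%E.
  apply: (@filter_ex _ (m^'-)).
  near=> c; split; first by near: c; exact: nbhs_left_lt.
  by move=> x Ux; have := near near_m c; apply.
have : m <= c.
  apply: ge_sup; first by exists c0.
  move=> c' [x Ux xc']; have := le_trans xc' (hc _ Ux).
  by rewrite lee_fin lerD2l.
by rewrite leNgt cm.
Unshelve. all: by end_near. Qed.

End Comparison.

(** * Decay along a strip *)

Section RealContinuity.
Context {R : realType} {T : topologicalType}.
Implicit Types (f g : T -> R) (x : T).

Lemma continuous_const (a : R) x : {for x, continuous (fun _ : T => a)}.
Proof. exact: cvg_cst. Qed.
Lemma continuous_add f g x : {for x, continuous f} -> {for x, continuous g} ->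
  {for x, continuous (fun y => f y + g y)}.
Proof. by move=> *; exact: cvgD. Qed.
Lemma continuous_mul f g x : {for x, continuous f} -> {for x, continuous g} ->
  {for x, continuous (fun y => f y * g y)}.
Proof. by move=> *; exact: cvgM. Qed.
Lemma continuous_opp f x : {for x, continuous f} ->
  {for x, continuous (fun y => - f y)}.
Proof. by move=> *; exact: cvgN. Qed.
Lemma continuous_inv f x : f x != 0 -> {for x, continuous f} ->
  {for x, continuous (fun y => (f y)^-1)}.
Proof. by move=> *; exact: cvgV. Qed.
Lemma continuous_lower f x e : {for x, continuous f} -> 0 < e ->
  \forall y \near x, f x - e < f y.
Proof.
move=> cf e0; have : f x - e < f x by lra.
by move=> /(cvgr_gt _ cf).
Qed.

End RealContinuity.

Section StripDecay.
Context {R : realType}.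
Implicit Types z : cplx R.

Lemma continuous_Rep : continuous (@Rep R : cplx R -> R).
Proof.
move=> z A /nbhs_ballP[e /= e0 eA]; apply/nbhs_cplxP; exists e => // w wz.
apply: eA; rewrite /ball /= distrC; apply: le_lt_trans wz.
by have := Rep_le (w - z); rewrite (CxE w) (CxE z) CxB.
Qed.

Lemma continuous_Imp : continuous (@Imp R : cplx R -> R).
Proof.
move=> z A /nbhs_ballP[e /= e0 eA]; apply/nbhs_cplxP; exists e => // w wz.
apply: eA; rewrite /ball /= distrC; apply: le_lt_trans wz.
by have := Imp_le (w - z); rewrite (CxE w) (CxE z) CxB.
Qed.

Lemma continuous_dist (z0 z : cplx R) :
  {for z, continuous (fun y : cplx R => cabs (y - z0))}.
Proof.
move=> A /nbhs_ballP[d /= d0 dA]; apply/nbhs_cplxP; exists d => // w wz.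
apply: dA; rewrite /ball /= ltr_norml.
by have := cabs_tri z z0 w; have := cabs_tri w z0 z; rewrite (cabsBC z w); lra.
Qed.

(** [along] and [across] are the coordinates of [z' - z] in the orthonormal
    frame whose first vector is [(c, s)]. *)
Definition along (c s : R) z z' : R :=
  c * (Rep z' - Rep z) + s * (Imp z' - Imp z).
Definition across (c s : R) z z' : R :=
  c * (Imp z' - Imp z) + (- s) * (Rep z' - Rep z).

Lemma along_across c s z z' : c ^+ 2 + s ^+ 2 = 1 ->
  along c s z z' ^+ 2 + across c s z z' ^+ 2 = cabs (z' - z) ^+ 2.
Proof.
move=> cs; rewrite (CxE z) (CxE z') CxB cabs_sqr /along /across /=.
set x := _ - _; set y := _ - _.
by rewrite -[RHS]mul1r -cs; ring.
Qed.

Lemma continuous_along c s z : continuous (along c s z : cplx R -> R).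
Proof.
move=> z'; rewrite /along.
apply: (@continuous_add R (cplx R)); apply: (@continuous_mul R (cplx R));
  try exact: (@continuous_const R (cplx R));
  apply: (@continuous_add R (cplx R)); try exact: (@continuous_const R (cplx R)).
  exact: continuous_Rep.
exact: continuous_Imp.
Qed.

Lemma continuous_across c s z : continuous (across c s z : cplx R -> R).
Proof.
move=> z'; rewrite /across.
apply: (@continuous_add R (cplx R)); apply: (@continuous_mul R (cplx R));
  try exact: (@continuous_const R (cplx R));
  apply: (@continuous_add R (cplx R)); try exact: (@continuous_const R (cplx R)).
  exact: continuous_Imp.
exact: continuous_Rep.
Qed.

(** Its Laplacian is [2 * (al - be)], negative for [al < be]; it grows along
    the strip and decreases across it. *)
Definition strip_barrier (M al be c s : R) z (x : sphere R) : R :=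
  if x is Some z' then M / 2 + al * along c s z z' ^+ 2
                       + (- be) * across c s z z' ^+ 2 else 0.

Lemma strip_barrier_supermean M al be c s z z1 r : c ^+ 2 + s ^+ 2 = 1 ->
  0 <= al < be -> 0 < r ->
  strict_supermean (strip_barrier M al be c s z) (Some z1) r.
Proof.
move=> cs /andP[al0 albe] r0.
pose X := along c s z z1; pose Y := across c s z z1.
apply: (@strict_supermean_trig _ _ _ _
  (M / 2 + al * (X ^+ 2 + r ^+ 2 * s ^+ 2) - be * (Y ^+ 2 + r ^+ 2 * c ^+ 2))
  (2 * r * (al * X * c + be * Y * s)) (2 * r * (al * X * s - be * Y * c))
  (r ^+ 2 * (al * (c ^+ 2 - s ^+ 2) - be * (s ^+ 2 - c ^+ 2)))
  (2 * r ^+ 2 * (al * c * s + be * c * s))).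
  move=> t; rewrite /strip_barrier /=.
  have -> : along c s z ((z1 : R[i]) + r%:C%C * expi t) = X + r * (c * cos t + s * sin t).
    by rewrite /X /along (CxE z1) /=; ring.
  have -> : across c s z ((z1 : R[i]) + r%:C%C * expi t) = Y + r * (c * sin t - s * cos t).
    by rewrite /Y /across (CxE z1) /=; ring.
  have := sin2cos2 t; move: (sin t) (cos t) => S C h.
  rewrite [leLHS](_ : _ = M / 2 +
    al * (X ^+ 2 + 2 * X * r * (c * C + s * S) +
      r ^+ 2 * (c ^+ 2 * C ^+ 2 + 2 * c * s * C * S + s ^+ 2 * S ^+ 2))
   - be * (Y ^+ 2 + 2 * Y * r * (c * S - s * C) +
      r ^+ 2 * (c ^+ 2 * S ^+ 2 - 2 * c * s * C * S + s ^+ 2 * C ^+ 2))); last by ring.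
  by rewrite h le_eqVlt; apply/orP; left; apply/eqP; ring.
rewrite /= -/X -/Y.
have -> : s ^+ 2 = 1 - c ^+ 2 by rewrite -cs; ring.
have r2 : 0 < r ^+ 2 by rewrite exprn_gt0.
have : 0 < r ^+ 2 * (be - al) by rewrite mulr_gt0// subr_gt0.
nra.
Qed.

(** [U] is a piece of the domain that lies in the disk of radius [3 * w] about
    [z] and in a strip of half-width [w]; it is relatively open and closed
    there, so that inside the disk its boundary belongs to [frontier Omega],
    where [u] is asymptotically nonpositive. With [x] and [y] for [along] and
    [across], compare [u] with [M * (1 / 2 + x ^+ 2 / (8 * w ^+ 2) - y ^+ 2 /
    (4 * w ^+ 2))]. It is superharmonic because [1 / 8 < 1 / 4]. In the strip
    it is at least [M / 4]. At distance at least [8 * w / 3] from [z] it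
    exceeds [M], because [64 / 9 / 8 - 3 / 8 + 1 / 2 > 1]. At [z] it is [M /
    2]. *)
Lemma strip_halving (Omega : set (sphere R)) (u : sphere R -> \bar R)
    (U : set (cplx R)) (z : cplx R) (c s w M : R) :
  open Omega -> subharmonic Omega u -> c ^+ 2 + s ^+ 2 = 1 -> 0 < w -> 0 < M ->
  open U -> U z ->
  (forall z', U z' -> Omega (Some z') /\ cabs (z' - z) < 3 * w) ->
  (forall zeta, Omega (Some zeta) -> cabs (zeta - z) < 3 * w -> ~ U zeta ->
    \forall z' \near zeta, ~ U z') ->
  (forall z', U z' -> `|across c s z z'| <= w) ->
  (forall z', U z' -> (u (Some z') <= M%:E)%E) ->
  (forall zeta, frontier Omega (Some zeta) -> cabs (zeta - z) < 3 * w ->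
    forall e : R, 0 < e ->
    \forall y \near (Some zeta : sphere R), Omega y -> (u y <= e%:E)%E) ->
  (u (Some z) <= (M / 2)%:E)%E.
Proof.
move=> oO su cs w0 M0 oU Uz UO clU strip uM bd.
pose al := M / 8 / w ^+ 2; pose be := M / 4 / w ^+ 2.
have w20 : 0 < w ^+ 2 by rewrite exprn_gt0.
have al0 : 0 < al by rewrite !divr_gt0.
have albe : al < be by rewrite /al /be ltr_pM2r ?invr_gt0//; lra.
have alw : al * w ^+ 2 = M / 8 by rewrite /al; field; rewrite gt_eqF.
have bew : be * w ^+ 2 = M / 4 by rewrite /be; field; rewrite gt_eqF.
pose v := strip_barrier M al be c s z.
have acr z' : U z' -> across c s z z' ^+ 2 <= w ^+ 2.
  by move=> Uz'; rewrite -real_normK ?num_real// lerXn2r ?nnegrE ?(ltW w0)// strip.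
have beacr z' : U z' -> be * across c s z z' ^+ 2 <= M / 4.
  by move=> Uz'; rewrite -bew ler_wpM2l ?acr//; lra.
have alacr z' : U z' -> al * across c s z z' ^+ 2 <= M / 8.
  by move=> Uz'; rewrite -alw ler_wpM2l ?acr//; lra.
have v0 z' : U z' -> M / 4 <= v (Some z').
  move=> Uz'; rewrite /v /strip_barrier; have := beacr _ Uz'.
  have : 0 <= al * along c s z z' ^+ 2 by rewrite mulr_ge0 ?sqr_ge0// ltW.
  lra.
have vM z' : U z' -> 8 * w <= 3 * cabs (z' - z) -> M <= v (Some z').
  move=> Uz' far; rewrite /v /strip_barrier; have := beacr _ Uz'; have := alacr _ Uz'.
  have : al * (64 / 9 * w ^+ 2) <= al * cabs (z' - z) ^+ 2.
    by rewrite ler_wpM2l//; [lra|nra].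
  rewrite -(along_across z z' cs) mulrDr => h.
  have : al * (64 / 9 * w ^+ 2) = 64 / 9 * (al * w ^+ 2) by ring.
  rewrite alw; lra.
have vz : v (Some z) = M / 2.
  by rewrite /v /strip_barrier /along /across !subrr; ring.
rewrite -vz.
apply: (@comparison _ Omega (Some @` U) u v M su); last by exists z.
- by move=> _ [z' Uz' <-]; exact: (UO _ Uz').1.
- exact: one_point_compactification_open_some.
- move=> _ [z' Uz' <-]; apply: le_trans (uM _ Uz') _.
  by rewrite lee_fin; have := v0 _ Uz'; lra.
- move=> _ [z' Uz' <-] e e0.
  suff : \forall y \near z', v (Some z') - e < v (Some y) by [].
  apply: (@continuous_lower R (cplx R) (fun y : cplx R => v (Some y))) => //.
  have h1 := @continuous_along c s z z'; have h2 := @continuous_across c s z z'.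
  rewrite /v /strip_barrier.
  have sqc (k : R) (g : cplx R -> R) : {for z', continuous g} ->
      {for z', continuous (fun y => k * g y ^+ 2)}.
    move=> cg; apply: (@continuous_mul R (cplx R)).
      exact: (@continuous_const R (cplx R)).
    exact: (@continuous_mul R (cplx R)).
  apply: (@continuous_add R (cplx R)); last exact: sqc.
  apply: (@continuous_add R (cplx R)); last exact: sqc.
  exact: (@continuous_const R (cplx R)).
- move=> _ [z' Uz' <-]; near=> r; apply: strip_barrier_supermean => //.
  by rewrite ltW.
- move=> [zeta|] nU e e0; last first.
    apply/nbhs_NoneP; split; first by case.
    exists (cabs z + 3 * w) => y yw [y' Uy' [yy]]; exfalso; move: yw; rewrite -yy.
    by have := (UO _ Uy').2; have := cabsD (y' - z) z; rewrite subrK; lra.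
  have nU' : ~ U zeta by move=> h; apply: nU; exists zeta.
  (* the points of [U] close to the circle of radius [3 * w] are at distance
     at least [8 * w / 3] from [z], where the barrier exceeds [M] *)
  have [zw|zw] := ltP (cabs (zeta - z)) (3 * w); last first.
    apply/nbhs_SomeP; exists (w / 3) => [|y yz [y' Uy' [yy]]]; first lra.
    rewrite -yy in yz *; apply: le_trans (uM _ Uy') _.
    have /(vM _ Uy') : 8 * w <= 3 * cabs (y' - z).
      by have := cabs_tri zeta z y'; rewrite (cabsBC zeta y'); lra.
    by rewrite lee_fin; lra.
  have [Oz|nOz] := pselect (Omega (Some zeta)).
    have /nbhs_cplxP[d d0 dU] := clU _ Oz zw nU'.
    by apply/nbhs_SomeP; exists d => // y /dU h [y' Uy' [yy]]; move: h; rewrite -yy.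
  have [cO|ncO] := pselect (closure Omega (Some zeta)).
    have fz : frontier Omega (Some zeta) by rewrite frontier_open.
    have := bd _ fz zw _ e0; apply: filterS => x hx [y Uy xy].
    move: hx; rewrite -xy => /(_ (UO _ Uy).1) h; apply: le_trans h _.
    by rewrite lee_fin; have := v0 _ Uy; lra.
  have : nbhs (Some zeta : sphere R) (~` closure Omega).
    by apply: open_nbhs_nbhs; split => //; exact/closed_openC/closed_closure.
  apply: filterS => x hx [y Uy xy]; case: hx; rewrite -xy.
  by apply: subset_closure; exact: (UO _ Uy).1.
Unshelve. all: by end_near. Qed.

(** Near [z] a relatively open and closed piece [U] of the domain lies in a
    strip of half-width [w]. Inside the disk the boundary of such a piece lies
    on the frontier of the domain, as the maximum principle requires, and [U]
    is easier to exhibit than a connected component. *)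
Definition strip_domain (Omega : set (sphere R)) (z0 : cplx R) (b w : R) :=
  forall z, Omega (Some z) ->
  cabs (z - z0) < b ->
  exists (c s : R) (U : set (cplx R)),
    [/\ c ^+ 2 + s ^+ 2 = 1, open U /\ U z,
    forall z', U z' -> Omega (Some z') /\ cabs (z' - z) < 3 * w,
    forall zeta, Omega (Some zeta) -> cabs (zeta - z) < 3 * w -> ~ U zeta ->
      \forall z' \near zeta, ~ U z' &
    forall z', U z' -> `|across c s z z'| <= w].

(** By [strip_halving], the bound at [z] is half a bound on the disk of radius
    [3 * w] about [z]; so the bound is halved when both ends of the ring move
    inwards by [3 * w]. *)
Lemma strip_decay (Omega : set (sphere R)) (u : sphere R -> \bar R)
    (z0 : cplx R) (a b w : R) :
  open Omega -> subharmonic Omega u -> 0 < w ->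
  (forall x, Omega x -> (u x <= 1%:E)%E) ->
  strip_domain Omega z0 b w ->
  (forall zeta, frontier Omega (Some zeta) -> a < cabs (zeta - z0) < b ->
    forall e : R, 0 < e ->
    \forall y \near (Some zeta : sphere R), Omega y -> (u y <= e%:E)%E) ->
  forall k z, Omega (Some z) -> a + k%:R * (3 * w) <= cabs (z - z0) ->
    cabs (z - z0) + k%:R * (3 * w) <= b -> (u (Some z) <= ((2 ^+ k)^-1)%:E)%E.
Proof.
move=> oO su w0 u1 strip bd; elim=> [|k IH] z Oz az zb.
  by rewrite expr0 invr1 u1.
move: az zb; rewrite -natr1 mulrDl mul1r => az zb.
have kw : 0 <= k%:R * (3 * w) by rewrite mulr_ge0// mulr_ge0// ltW.
have [|c [s [U [cs [oU Uz] UO clU Uw]]]] := strip _ Oz; first lra.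
have -> : (2 ^+ k.+1)^-1 = (2 ^+ k)^-1 / 2 :> R by rewrite exprS invfM mulrC.
apply: (strip_halving oO su cs w0 _ oU Uz UO clU Uw).
- by rewrite invr_gt0 exprn_gt0.
- move=> z' Uz'; have [Oz' zz'] := UO _ Uz'; apply: IH => //.
    by have := cabs_tri z z0 z'; rewrite (cabsBC z z'); lra.
  by have := cabs_tri z' z0 z; lra.
- move=> zeta fz zz; apply: bd => //.
  have := cabs_tri z z0 zeta; have := cabs_tri zeta z0 z.
  by rewrite (cabsBC z zeta) => *; apply/andP; split; lra.
Qed.

End StripDecay.

(** * Propagation of a bound away from a ring *)

Section OuterDecay.
Context {R : realType}.
Implicit Types z : cplx R.

(** The Laplacian of [|z| ^- 2] is [4 * |z| ^- 4], so that its opposite is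
    strictly superharmonic. Unlike a logarithm it is bounded near infinity,
    and there too it is strictly superharmonic because infinity is where it is
    largest. *)
Definition outer_barrier (eta ka K : R) z0 (x : sphere R) : R :=
  if x is Some z then eta + ka * (K - (cabs (z - z0) ^+ 2)^-1) else eta + ka * K.

Lemma circleE z r t :
  (z : R[i]) + r%:C%C * expi t = Cx (Rep z + r * cos t) (Imp z + r * sin t).
Proof.
rewrite {1}(CxE z) -[r%:C%C * _]/(Cx (r * cos t - 0 * sin t) (r * sin t + 0 * cos t)).
by rewrite CxD !mul0r subr0 addr0.
Qed.

(** For [C = c + r ^+ 2] this is the identity [(C + L)^-1 = C^-1 - L / C ^+ 2
    + L ^+ 2 / (C ^+ 2 * (C + L))], in which the last denominator is bounded
    by [C + L <= 3 / 2 * c]. It bounds the inverse of a trigonometric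
    polynomial of degree 1 by one of degree 2, whose integral is explicit. *)
Lemma inv_taylor_lower (c r L : R) : 0 < c -> 0 < r -> 10 * r ^+ 2 <= c / 10 ->
  L ^+ 2 <= 4 * r ^+ 2 * c ->
  (c + r ^+ 2)^-1 - L / (c + r ^+ 2) ^+ 2
    + L ^+ 2 / ((c + r ^+ 2) ^+ 2 * (3 / 2 * c)) <= (c + r ^+ 2 + L)^-1.
Proof.
move=> c0 r0 rc Lc.
have r20 : 0 < r ^+ 2 by rewrite exprn_gt0.
have Lc2 : L ^+ 2 <= (c / 5) ^+ 2 by nra.
have [La Lb] : L <= c / 5 /\ - (c / 5) <= L.
  by split; rewrite leNgt; apply/negP => h; nra.
set C := c + r ^+ 2.
have C0 : 0 < C by rewrite /C; lra.
have CL0 : 0 < C + L by rewrite /C; lra.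
have -> : (C + L)^-1 = C^-1 - L / C ^+ 2 + L ^+ 2 / (C ^+ 2 * (C + L)).
  by field; rewrite !gt_eqF.
have C2 : 0 < C ^+ 2 by rewrite exprn_gt0.
have h1 : 0 < C ^+ 2 * (C + L) by rewrite mulr_gt0.
have h2 : 0 < C ^+ 2 * (3 / 2 * c) by rewrite mulr_gt0//; lra.
rewrite lerD2l ler_wpM2l ?sqr_ge0// lef_pV2 ?posrE//.
by rewrite ler_wpM2l ?sqr_ge0// /C; lra.
Qed.

(** On the circle of radius [r] about [z1] the squared distance to [z0] is [c
    + r ^+ 2 + L], with [L] of mean 0 and of mean square [2 * r ^+ 2 * c]. By
    [inv_taylor_lower] with [C = c + r ^+ 2] the mean of its inverse is at
    least [C^-1 + 4 / 3 * r ^+ 2 / C ^+ 2]. The second term outweighs the loss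
    [c^-1 - C^-1 = r ^+ 2 / (c * C)], because [C < 4 / 3 * c]. *)
Lemma outer_barrier_supermean_Some eta ka K z0 z1 : 0 < ka -> 0 < cabs (z1 - z0) ->
  \forall r \near (0 : R)^'+,
    strict_supermean (outer_barrier eta ka K z0) (Some z1) r.
Proof.
move=> ka0 z10; pose c := cabs (z1 - z0) ^+ 2.
have c0 : 0 < c by rewrite exprn_gt0.
near=> r; have r0 : 0 < r by [].
have rc : 10 * r ^+ 2 <= c / 10.
  have : r <= cabs (z1 - z0) / 10 by near: r; apply: nbhs_right_le; lra.
  by rewrite /c; nra.
have r20 : 0 < r ^+ 2 by rewrite exprn_gt0.
pose p := Rep z1 - Rep z0; pose q := Imp z1 - Imp z0.
have pq : p ^+ 2 + q ^+ 2 = c.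
  by rewrite /c (CxE z1) (CxE z0) CxB cabs_sqr.
pose C := c + r ^+ 2.
have C0 : 0 < C by rewrite /C; lra.
pose G := (C ^+ 2 * (3 / 2 * c))^-1.
have G0 : 0 < G by rewrite invr_gt0 mulr_gt0 ?exprn_gt0//; lra.
apply: (@strict_supermean_trig _ _ _ _
  (eta + ka * (K - C^-1 - 4 * r ^+ 2 * q ^+ 2 * G))
  (ka * (2 * r * p) / C ^+ 2) (ka * (2 * r * q) / C ^+ 2)
  (- ka * 4 * r ^+ 2 * (p ^+ 2 - q ^+ 2) * G)
  (- ka * 8 * r ^+ 2 * p * q * G)).
  move=> t /=.
  have -> : cabs (((z1 : R[i]) + r%:C%C * expi t) - z0) ^+ 2 =
      c + r ^+ 2 + 2 * r * (p * cos t + q * sin t).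
    have -> : ((z1 : R[i]) + r%:C%C * expi t) - z0 =
        Cx (p + r * cos t) (q + r * sin t).
      rewrite circleE {1}(CxE z0) CxB; congr Cx; rewrite /p /q; ring.
    rewrite cabs_sqr -pq [LHS](_ : _ = p ^+ 2 + q ^+ 2 +
      r ^+ 2 * (cos t ^+ 2 + sin t ^+ 2) + 2 * r * (p * cos t + q * sin t)); last by ring.
    by rewrite cos2Dsin2 mulr1.
  set L := 2 * r * _.
  have LE : L ^+ 2 = 4 * r ^+ 2 * (p ^+ 2 * cos t ^+ 2 +
      2 * p * q * (sin t * cos t) + q ^+ 2 * (1 - cos t ^+ 2)).
    by rewrite -sin2cos2 /L; ring.
  have Lc : L ^+ 2 <= 4 * r ^+ 2 * c.
    rewrite -subr_ge0 (_ : _ - _ = 4 * r ^+ 2 * (p * sin t - q * cos t) ^+ 2).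
      by rewrite mulr_ge0 ?sqr_ge0// mulr_ge0// sqr_ge0.
    rewrite -pq [4 * _ * _ in LHS](_ : _ = 4 * r ^+ 2 * (p ^+ 2 + q ^+ 2) *
      (cos t ^+ 2 + sin t ^+ 2)); last by rewrite cos2Dsin2 mulr1.
    by rewrite /L; ring.
  have := inv_taylor_lower c0 r0 rc Lc; rewrite -/C -/G LE => h.
  have {h} := ler_wpM2l (ltW ka0) h.
  rewrite /L; lra.
rewrite /= -/c.
have -> : q ^+ 2 = c - p ^+ 2 by rewrite -pq; ring.
suff : c^-1 < C^-1 + 2 * r ^+ 2 * c * G.
  by move=> h; have := ltr_pM2l ka0 (c^-1) (C^-1 + 2 * r ^+ 2 * c * G); rewrite h; lra.
rewrite /G -subr_gt0.
have -> : C^-1 + 2 * r ^+ 2 * c * (C ^+ 2 * (3 / 2 * c))^-1 - c^-1 =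
   r ^+ 2 * (4 / 3 * c - C) / (C ^+ 2 * c).
  by rewrite /C; field; rewrite -/C !gt_eqF.
by rewrite divr_gt0 ?mulr_gt0 ?exprn_gt0// /C; lra.
Unshelve. all: by end_near. Qed.

(** The small circles about infinity are the circles of radius [r^-1] about 0,
    and on them the distance to [z0] is at most [r^-1 + cabs z0]. *)
Lemma outer_barrier_supermean_None eta ka K z0 : 0 < ka ->
  \forall r \near (0 : R)^'+,
    strict_supermean (outer_barrier eta ka K z0) None r.
Proof.
move=> ka0; near=> r; have r0 : 0 < r by [].
pose N := r^-1 + cabs z0.
have N0 : 0 < N by rewrite ltr_wpDr ?cabs_ge0 ?invr_gt0.
apply: (@strict_supermean_trig _ _ _ _ (eta + ka * (K - (N ^+ 2)^-1)) 0 0 0 0).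
  move=> t /=; rewrite !mul0r !addr0 lerD2l ler_wpM2l ?(ltW ka0)// lerD2l lerN2.
  set y := _^-1%R - z0.
  have yN : cabs y <= N.
    apply: le_trans (cabsD _ _) _; rewrite cabsN lerD2r.
    by rewrite /cabs Normc.normcV -/(cabs _) cabsM cabs_expi mulr1 cabs_real gtr0_norm.
  (* the small circle about infinity does not pass through [z0], where the
     inverse would be the default value 0 *)
  have y0 : 0 < cabs y.
    have := cabs_tri (r%:C%C * expi t)^-1 0 z0; rewrite !subr0 -/y.
    have -> : cabs ((r%:C%C * expi t)^-1 : cplx R) = r^-1.
      by rewrite /cabs Normc.normcV -/(cabs _) cabsM cabs_expi mulr1 cabs_real gtr0_norm.
    have : cabs z0 < r^-1.
      have rz : r < (cabs z0 + 1)^-1.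
        by near: r; apply: nbhs_right_lt; rewrite invr_gt0 ltr_wpDl ?cabs_ge0.
      have : cabs z0 + 1 < r^-1.
        by rewrite -ltf_pV2 ?posrE ?invr_gt0// ?invrK// ltr_wpDl ?cabs_ge0.
      lra.
    lra.
  rewrite lef_pV2 ?posrE ?exprn_gt0//.
  by rewrite ler_pXn2r ?nnegrE ?cabs_ge0 ?(ltW N0).
rewrite /= mul0r addr0 ltrD2l ltr_pM2l//.
by rewrite gtrBl invr_gt0 exprn_gt0.
Unshelve. all: by end_near. Qed.

(** [outside] and [coutside] are the open and the closed exterior of a disk,
    both containing infinity. *)
Definition outside (z0 : cplx R) (s : R) : set (sphere R) :=
  [set x | if x is Some z then s < cabs (z - z0) else True].

Definition coutside (z0 : cplx R) (s : R) : set (sphere R) :=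
  [set x | if x is Some z then s <= cabs (z - z0) else True].

Lemma open_outside z0 s : open (outside z0 s).
Proof.
rewrite openE => -[z|] /= zs; rewrite /interior.
  apply/nbhs_SomeP; exists (cabs (z - z0) - s); first by rewrite subr_gt0.
  by move=> w; rewrite /= -[w - z]opprB cabsN; have := cabs_tri z z0 w; lra.
apply/nbhs_NoneP; split => //; exists (s + cabs z0) => w /=.
by have := cabsD (w - z0) z0; rewrite subrK; lra.
Qed.

Lemma outer_barrier_lower eta ka K z0 x e : 0 < ka ->
  outside z0 0 x -> 0 < e ->
  \forall y \near x, outer_barrier eta ka K z0 x - e < outer_barrier eta ka K z0 y.
Proof.
move=> ka0; case: x => [z|] z_neq e0.
  suff : \forall y \near z, outer_barrier eta ka K z0 (Some z) - e <
    outer_barrier eta ka K z0 (Some y) by [].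
  apply: (@continuous_lower R (cplx R)
    (fun y => outer_barrier eta ka K z0 (Some y))) => //.
  apply: (@continuous_add R (cplx R)); first exact: (@continuous_const R (cplx R)).
  apply: (@continuous_mul R (cplx R)); first exact: (@continuous_const R (cplx R)).
  apply: (@continuous_add R (cplx R)); first exact: (@continuous_const R (cplx R)).
  have cc := @continuous_dist R z0 z.
  have z2 : cabs (z - z0) ^+ 2 != 0 by rewrite gt_eqF// exprn_gt0.
  suff : {for z, continuous (fun y : cplx R => - (cabs (y - z0) ^+ 2)^-1)} by [].
  apply: (@continuous_opp R (cplx R)); apply: (@continuous_inv R (cplx R)) => //.
  exact: (@continuous_mul R (cplx R)).
move: z_neq => _; rewrite /outer_barrier.
apply/nbhs_NoneP; split; first by lra.
pose N := ka / e + 1.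
have N1 : 1 < N by rewrite ltrDr divr_gt0.
exists (N + cabs z0) => w wN /=.
have wz : N < cabs (w - z0) by have := cabsD (w - z0) z0; rewrite subrK; lra.
have wz0 : 0 < cabs (w - z0) by lra.
suff : ka / cabs (w - z0) ^+ 2 < e by lra.
rewrite ltr_pdivrMr ?exprn_gt0//.
have : ka < e * N by rewrite /N mulrDr mulrCA divff ?gt_eqF//; lra.
have : N < cabs (w - z0) ^+ 2 by nra.
nra.
Qed.

(** Compare [u] with [eta + ka * (s ^- 2 - |z - z0| ^- 2)], which is at least
    [eta] outside the disk of radius [s]. The strictness of this barrier is
    lost as [ka] tends to 0, and the bound [eta] remains. A whole ring, from
    [s] to [s'], is assumed to satisfy the bound in order that it hold near
    each point of the inner circle. *)
Lemma outer_decay (Omega : set (sphere R)) (u : sphere R -> \bar R)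
    (z0 : cplx R) (s s' eta : R) :
  open Omega -> subharmonic Omega u -> 0 < s -> s < s' -> 0 <= eta ->
  (forall x, Omega x -> (u x <= 1%:E)%E) ->
  (forall z, Omega (Some z) -> s <= cabs (z - z0) < s' ->
    (u (Some z) <= eta%:E)%E) ->
  (forall x, frontier Omega x ->
    coutside z0 s x ->
    forall e : R, 0 < e -> \forall y \near x, Omega y -> (u y <= e%:E)%E) ->
  forall x, Omega x -> coutside z0 s x ->
    (u x <= eta%:E)%E.
Proof.
move=> oO su s0 ss' eta0 u1 ueta bd x Ox xs.
have [xs'|xs'] := pselect (outside z0 s x); last first.
  case: x Ox xs xs' => [z|] Ox xs xs'; last by exfalso; exact: xs'.
  apply: ueta => //; rewrite xs/=; move: xs' => /= /negP; rewrite -leNgt => xs'.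
  exact: le_lt_trans xs' ss'.
have step ka : 0 < ka -> (u x <= (outer_barrier eta ka (s ^+ 2)^-1 z0 x)%:E)%E.
  move=> ka0; pose v := outer_barrier eta ka (s ^+ 2)^-1 z0.
  have v_eta y : outside z0 s y -> eta <= v y.
    case: y => [z|] /= ys; last first.
      by rewrite lerDl mulr_ge0 ?invr_ge0 ?sqr_ge0// ltW.
    rewrite lerDl mulr_ge0// ?(ltW ka0)// subr_ge0 lef_pV2 ?posrE ?exprn_gt0//; last lra.
    by rewrite ler_pXn2r ?nnegrE ?(ltW s0) ?cabs_ge0// ltW.
  have vpos y : outside z0 s y -> outside z0 0 y.
    by case: y => [z|] //=; exact: lt_trans.
  apply: (@comparison _ Omega (Omega `&` outside z0 s) u v 1 su); last by split.
  - exact: subIsetl.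
  - by apply: openI => //; exact: open_outside.
  - move=> y [Oy ys]; apply: le_trans (u1 _ Oy) _.
    by rewrite lee_fin; have := v_eta _ ys; lra.
  - by move=> y [Oy ys] e e0; apply: outer_barrier_lower => //; exact: vpos.
  - move=> [z|] [Oy ys]; last exact: outer_barrier_supermean_None.
    by apply: outer_barrier_supermean_Some => //; exact: lt_trans ys.
  move=> y nUy c c0.
  have [Oy|nOy] := pselect (Omega y).
    case: y nUy Oy => [z|] nUy Oy; last by exfalso; apply: nUy.
    have zs : cabs (z - z0) <= s by rewrite leNgt; apply/negP => h; apply: nUy.
    apply/nbhs_SomeP; exists (s' - s) => [|w wz [Ow ws]]; first by rewrite subr_gt0.
    apply: (@le_trans _ _ eta%:E); last first.
      by rewrite lee_fin; have := v_eta _ ws; lra.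
    apply: ueta => //; move: ws => /= ws; rewrite ltW//=.
    by have := cabs_tri w z0 z; lra.
  have [cO|ncO] := pselect (closure Omega y); last first.
    have : nbhs y (~` closure Omega).
      by apply: open_nbhs_nbhs; split => //; exact/closed_openC/closed_closure.
    apply: filterS => w ncw [Ow _]; exfalso; apply: ncw.
    by apply: (@subset_closure _ Omega).
  have fy : frontier Omega y by rewrite frontier_open.
  have [ys|ys] := pselect (coutside z0 s y).
    have := bd y fy ys c c0; apply: filterS => w uw [Ow ws].
    by apply: le_trans (uw Ow) _; rewrite lee_fin; have := v_eta _ ws; lra.
  case: y ys {fy cO nOy nUy} => [z|] //= /negP; rewrite -ltNge => zs.
  apply/nbhs_SomeP; exists (s - cabs (z - z0)) => [|w wz [Ow /= ws]].
    by rewrite subr_gt0.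
  by exfalso; have := cabs_tri w z0 z; lra.
apply/lee_addgt0Pr => e e0.
have s20 : 0 < s ^+ 2 by rewrite exprn_gt0.
have ka0 : 0 < e * s ^+ 2 by rewrite mulr_gt0.
apply: le_trans (step _ ka0) _; rewrite -EFinD lee_fin.
case: x {Ox xs xs' step} => [z|] /=.
  rewrite lerD2l mulrBr -mulrA divff ?gt_eqF// mulr1.
  by rewrite lerBlDl lerDr mulr_ge0 ?invr_ge0 ?sqr_ge0// ltW.
by rewrite lerD2l -mulrA divff ?gt_eqF// mulr1.
Qed.

End OuterDecay.

(** * A cusp is a thin strip *)

Section PowerSeriesBound.
Context {R : realType}.

Lemma pseries0 (c : nat -> R) n : pseries c 0 n.+1 = c 0%N.
Proof.
rewrite /pseries /series /= big_nat_recl// expr0 mulr1 big1 ?addr0// => i _.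
by rewrite exprS mul0r mulr0.
Qed.

(** The value at 0 forces the constant coefficient to vanish. The series
    converges at some [x > 0], hence absolutely at [x / 2], and without its
    constant term its size at [r] is at most [r / (x / 2)] times the absolute
    series at [x / 2]. *)
Lemma power_expansion_lipschitz0 (c : nat -> R) (h : R -> R) :
  h 0 = 0 -> power_expansion c h ->
  exists2 C : R, 0 < C & \forall r \near (0 : R)^'+, `|h r| <= C * r.
Proof.
move=> h0 ch.
have chr : \forall x \near (0 : R)^'+, pseries c x @ \oo --> h x.
  exact: cvg_within ch.
have c0 : c 0%N = 0.
  have cv0 : pseries c 0 @ \oo --> (0 : R) by have := nbhs_singleton ch; rewrite h0.
  have cvc : pseries c 0 @ \oo --> (c 0%N : R).
    rewrite -(cvg_shiftS (pseries c 0)); under eq_fun do rewrite pseries0.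
    exact: cvg_cst.
  by rewrite -(cvg_lim (@Rhausdorff R) cvc); exact: (cvg_lim (@Rhausdorff R) cv0).
have [x [x0 cvx]] : exists x : R, 0 < x /\ pseries c x @ \oo --> h x.
  apply: (@filter_ex _ ((0 : R)^'+)); near=> x; split=> //.
  by near: x.
have cvn : cvgn (pseries (fun i => `|c i|) (x / 2)).
  apply: (@is_cvg_pseries_inside_norm _ _ x); first by apply/cvg_ex; exists (h x).
  by rewrite !gtr0_norm//; lra.
pose S := limn (pseries (fun i => `|c i|) (x / 2)).
have x20 : 0 < x / 2 by lra.
have ndS : nondecreasing_seq (pseries (fun i => `|c i|) (x / 2)).
  apply: nondecreasing_series => n _ _.
  by rewrite mulr_ge0// exprn_ge0// ltW.
have leS n : pseries (fun i => `|c i|) (x / 2) n <= S.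
  by have := nondecreasing_cvgn_le ndS cvn n.
have S0 : 0 <= S by apply: le_trans (leS 0%N); rewrite /pseries /series /= big_geq.
exists ((S + 1) / (x / 2)); first by rewrite divr_gt0//; lra.
near=> r; have r0 : 0 < r by [].
have rx : r <= x / 2 by near: r; exact: nbhs_right_le.
have cvr : pseries c r @ \oo --> h r by near: r.
have bnd n : `|pseries c r n| <= (S + 1) / (x / 2) * r.
  have h1 : `|pseries c r n| <= r / (x / 2) * pseries (fun i => `|c i|) (x / 2) n.
    rewrite /pseries /series /= mulr_sumr; apply: le_trans (ler_norm_sum _ _ _) _.
    apply: ler_sum => -[|i] _; first by rewrite c0 mul0r normr0 mul0r mulr0.
    rewrite normrM (@ger0_norm _ (r ^+ _)) ?exprn_ge0 ?(ltW r0)//.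
    have e : r / (x / 2) * (x / 2) ^+ i.+1 = r * (x / 2) ^+ i.
      by rewrite exprS mulrA divfK ?gt_eqF.
    rewrite mulrCA ler_wpM2l// e exprS.
    by rewrite ler_wpM2l ?(ltW r0)// lerXn2r// ?nnegrE ltW.
  apply: le_trans h1 _.
  have -> : (S + 1) / (x / 2) * r = r / (x / 2) * (S + 1) by ring.
  by rewrite ler_wpM2l ?divr_ge0 ?(ltW r0) ?(ltW x20)//; have := leS n; lra.
have cvN : `|pseries c r n| @[n --> \oo] --> `|h r| by exact: cvg_norm cvr.
rewrite -(cvg_lim (@Rhausdorff R) cvN); apply: limr_le.
  by apply/cvg_ex; exists `|h r|.
by near=> n; exact: bnd.
Unshelve. all: by end_near. Qed.

End PowerSeriesBound.

Section CuspGeometry.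
Context {R : realType}.
Implicit Types z : cplx R.

Lemma normr_sin_le (x : R) : `|sin x| <= `|x|.
Proof.
wlog x0 : x / 0 <= x.
  move=> H; have [|/ltW x0] := leP 0 x; first exact: H.
  by rewrite -normrN -sinN -[leRHS]normrN; apply: H; rewrite oppr_ge0.
have cs : {within `[0, x], continuous (@sin R)}.
  by apply: continuous_subspaceT => y; exact: continuous_sin.
have [c _] := MVT_segment x0 (fun y _ => is_derive_sin y) cs.
rewrite sin0 !subr0 => ->; rewrite normrM ler_piMl//.
exact: cos_max.
Qed.

Lemma cos_eq_norm (x y : R) : `|x| <= pi -> `|y| <= pi -> cos x = cos y ->
  `|x| = `|y|.
Proof.
have cn (t : R) : cos `|t| = cos t by case: (ger0P t) => // _; rewrite cosN.
move=> xp yp cxy; apply: cos_inj; rewrite ?in_itv /= ?normr_ge0//.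
by rewrite !cn.
Qed.

(** Arguments are known modulo [2 * pi] only; the cosine of a difference is a
    quantity that does not depend on the choice. *)
Lemma expi_rot_cos (u : cplx R) (A B t s : R) : cabs u = 1 ->
  expi A = (u : R[i]) * expi t -> expi B = (u : R[i]) * expi s ->
  cos (A - B) = cos (t - s).
Proof.
case: u => a b u1; have ab : a ^+ 2 + b ^+ 2 = 1.
  by rewrite -(cabs_sqr a b) -[Cx a b]/(a +i* b)%C u1 expr1n.
move=> [cA sA] [cB sB]; rewrite !cosB cA sA cB sB.
rewrite -[RHS]mul1r -ab; ring.
Qed.

Lemma expi_inj_rot (z0 u : cplx R) (r r' A t : R) : cabs u = 1 -> 0 < r -> 0 < r' ->
  polar_point z0 1 r A = polar_point z0 u r' t -> r = r' /\ expi A = (u : R[i]) * expi t.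
Proof.
move=> u1 r0 r'0; rewrite /polar_point => /addrI; rewrite mul1r => E.
have : r = r'.
  have := congr1 cabs E.
  by rewrite !cabsM !cabs_expi u1 !cabs_real !gtr0_norm// mul1r !mulr1.
move=> rr; split => //; move: E; rewrite -rr mulrCA => E.
apply: (@mulfI _ (r%:C%C : R[i])) => //.
by apply/eqP => -[] /eqP; rewrite gt_eqF.
Qed.

Lemma nbhs_right0_ex (P : R -> Prop) : (\forall x \near (0 : R)^'+, P x) ->
  exists2 r1 : R, 0 < r1 & forall x, 0 < x < r1 -> P x.
Proof.
move=> /nbhs_ballP[e /= e0 eP]; exists e => // x /andP[x0 xe].
by apply: eP => //=; rewrite /ball /= sub0r normrN gtr0_norm.
Qed.

Lemma open_plane_part (Omega : set (sphere R)) : open Omega ->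
  open [set z : cplx R | Omega (Some z)].
Proof.
by move=> oO; rewrite openE => z Oz; exact: (open_nbhs_nbhs (conj oO Oz)).
Qed.

(** The power map sends the domain near [z0] between two arcs that are tangent
    to the direction [u] and whose angles are Lipschitz at 0. Hence [p * tau
    z] agrees with the argument of [u] up to [C * |z - z0| `^ p], but only
    modulo [2 * pi], whence the formulation with [expi]. *)
Lemma cusp_angle (Omega : set (sphere R)) (z0 : cplx R) (p : R) :
  open Omega -> has_cusp_exponent Omega z0 p ->
  exists (C b0 : R) (tau : cplx R -> R) (u : cplx R),
    [/\ 0 < C, 0 < b0, cabs u = 1,
     forall z, Omega (Some z) -> cabs (z - z0) < b0 ->
       [/\ 0 < cabs (z - z0), {for z, continuous tau} &
        z = polar_point z0 1 (cabs (z - z0)) (tau z)] &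
     forall z, Omega (Some z) -> cabs (z - z0) < b0 ->
       exists2 t : R, `|t| <= C * cabs (z - z0) `^ p &
         expi (p * tau z) = (u : R[i]) * expi t].
Proof.
move=> oO [fz0 p0 [r [tau []]]]; set V := _ `&` _; set W := _ @` V.
move=> r0 [ctau tauE] _ [thp [thm [cp [cm [d [ac [ecp ecm] _ _ _]]]]]].
have [thp0 thm0 [e [wp [wm [_ _ _ _ [u [delta [u1 delta0 _ _ WE]]]]]]]] := ac.
have [Cp Cp0 hp] := power_expansion_lipschitz0 thp0 ecp.
have [Cm Cm0 hm] := power_expansion_lipschitz0 thm0 ecm.
have [r1 r10 hr1] : exists2 r1 : R, 0 < r1 & forall x, 0 < x < r1 ->
    `|thp x| <= Cp * x /\ `|thm x| <= Cm * x.
  have : \forall x \near (0 : R)^'+, `|thp x| <= Cp * x /\ `|thm x| <= Cm * x.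
    by near=> x; split; near: x.
  by move=> /nbhs_right0_ex.
pose b0 := Num.min r (Num.min (delta `^ p^-1) (r1 `^ p^-1)).
have b00 : 0 < b0 by rewrite !lt_min r0 !powR_gt0.
have z0nO : ~ Omega (Some z0) by move: fz0; rewrite frontier_open// => -[].
have VP z : Omega (Some z) -> cabs (z - z0) < b0 -> V z.
  by move=> Oz zb; split => //; apply: lt_le_trans zb _; rewrite ge_min lexx.
have zpos z : Omega (Some z) -> 0 < cabs (z - z0).
  move=> Oz; rewrite lt_neqAle cabs_ge0 andbT eq_sym; apply/eqP => /cabs_eq0/eqP.
  by rewrite subr_eq0 => /eqP zz; apply: z0nO; rewrite -zz.
have oV : open V.
  by apply: openI; [exact: open_plane_part|exact: open_cdisk].
exists (Cp + Cm), b0, tau, u; split => //; first exact: addr_gt0.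
  move=> z Oz zb; split; [exact: zpos| |].
    have := ctau; rewrite continuous_open_subspace// => /(_ z); apply.
    by rewrite inE; exact: VP.
  exact: tauE (VP _ Oz zb).
move=> z Oz zb; have Vz := VP _ Oz zb; have zp := zpos _ Oz.
pose rho := cabs (z - z0) `^ p.
have rho0 : 0 < rho by rewrite powR_gt0.
have rhoE x : 0 < x -> cabs (z - z0) < x `^ p^-1 -> rho < x.
  move=> x0 zx; rewrite /rho -[ltRHS](@powRr1 _ x) ?(ltW x0)//.
  rewrite -(@mulVf _ p) ?gt_eqF// powRrM gt0_ltr_powR// ?nnegrE ?cabs_ge0 ?powR_ge0//.
move: zb; rewrite !lt_min => /and3P[zr zd zr1].
have : (W `&` cdisk z0 delta) (power_map z0 p tau z).
  split; first by exists z.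
  rewrite /cdisk /= /power_map /polar_point mul1r addrAC subrr add0r.
  by rewrite cabsM cabs_expi mulr1 cabs_real gtr0_norm// rhoE.
rewrite WE => -[r' [t [/andP[r'0 r'd] /andP[tm tp]]]].
move=> /(expi_inj_rot u1 rho0 r'0)[rr Et].
exists t => //; rewrite -/rho rr.
have [|h1 h2] := hr1 r'; first by rewrite r'0 -rr rhoE.
move: h1 h2; rewrite !ler_norml => /andP[_ h1] /andP[h2 _].
by apply/andP; split; nra.
Unshelve. all: by end_near. Qed.

(** By [cusp_angle] the values of [p * tau] at any two points of a small disk
    about [z0] differ by a multiple of [2 * pi] up to [O(B `^ p)], where [B =
    b + 3 * w]. Therefore the inequality [|p * tau z' - p * tau z| < pi]
    defines a set [U] that is closed as well as open: on [U] the difference is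
    at once [O(B `^ p)]. The coordinate of [z'] across the direction [tau z]
    is [|z' - z0| * sin (tau z' - tau z)], which is [O(B `^ (1 + p))] on [U].
    *)
Lemma cusp_strip (Omega : set (sphere R)) (z0 : cplx R) (p : R) :
  open Omega -> has_cusp_exponent Omega z0 p ->
  exists C b0 : R, [/\ 0 < C, 0 < b0 & forall b w, 0 < b -> 0 < w ->
    b + 3 * w <= b0 -> C * (b + 3 * w) `^ (1 + p) <= w ->
    strip_domain Omega z0 b w].
Proof.
move=> oO hc; have [C0 [b0 [tau [u [C00 b00 u1 polarE angle]]]]] := cusp_angle oO hc.
have p0 : 0 < p by case: hc.
have pi0 := pi_gt0 R.
pose b1 := Num.min b0 ((4 * C0)^-1 `^ p^-1).
have b10 : 0 < b1 by rewrite lt_min b00 powR_gt0// invr_gt0; lra.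
exists (2 * C0 / p), b1; split => //; first by rewrite divr_gt0//; lra.
move=> b w b_gt0 w0 bw Cw z Oz zb.
pose B := b + 3 * w; have B0 : 0 < B by rewrite /B; lra.
have b1b0 : b1 <= b0 by rewrite /b1 ge_min; apply/orP; left; apply: lexx.
have Bb0 : B <= b0 by exact: le_trans bw b1b0.
have BpE : C0 * B `^ p <= 1 / 4.
  have : B `^ p <= (4 * C0)^-1.
    have -> : (4 * C0)^-1 = ((4 * C0)^-1 `^ p^-1) `^ p.
      by rewrite -powRrM mulVf ?gt_eqF// powRr1// invr_ge0; lra.
    rewrite ge0_ler_powR ?nnegrE ?(ltW p0) ?(ltW B0) ?powR_ge0//.
    by apply: le_trans bw _; rewrite /b1 ge_min; apply/orP; right; apply: lexx.
  have -> : (4 * C0)^-1 = C0^-1 / 4 by rewrite invfM mulrC.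
  by rewrite -(ler_pM2l C00) mulrA divff ?gt_eqF.
have inB z' : cabs (z' - z) < 3 * w -> cabs (z' - z0) < B.
  by have := cabs_tri z' z0 z; rewrite /B; lra.
have zB : cabs (z - z0) < B by rewrite /B; lra.
have angB z' : Omega (Some z') -> cabs (z' - z0) < B ->
    exists2 t, `|t| <= C0 * B `^ p & expi (p * tau z') = (u : R[i]) * expi t.
  move=> Oz' z'B; have [|t tC tE] := angle z' Oz'; first exact: lt_le_trans Bb0.
  exists t => //; apply: le_trans tC _; rewrite ler_wpM2l ?(ltW C00)//.
  by rewrite ge0_ler_powR ?nnegrE ?(ltW p0) ?cabs_ge0// ltW.
have pi2 : 2 <= pi :> R by exact: pi_ge2.
(* up to sign and modulo [2 * pi] the difference is that of two angles below
   [1 / 4]; being at most [pi], it equals it in absolute value *)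
have gap z' : Omega (Some z') -> cabs (z' - z0) < B ->
    `|p * tau z' - p * tau z| <= pi ->
    `|p * tau z' - p * tau z| <= 2 * (C0 * B `^ p).
  move=> Oz' z'B small.
  have [t tC tE] := angB z' Oz' z'B; have [t1 tC1 tE1] := angB z Oz zB.
  have tt : `|t - t1| <= 2 * (C0 * B `^ p).
    by apply: le_trans (ler_normB _ _) _; lra.
  rewrite (cos_eq_norm small _ (expi_rot_cos u1 tE tE1))//.
  by apply: le_trans tt _; lra.
pose U := [set z' : cplx R | Omega (Some z')] `&` cdisk z (3 * w) `&`
  [set z' | `|p * tau z' - p * tau z| < pi].
have near_tau zeta : Omega (Some zeta) -> cabs (zeta - z0) < B ->
    {for zeta, continuous (fun z' : cplx R => `|p * tau z' - p * tau z|)}.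
  move=> Oze zeB; have [|_ ct _] := polarE _ Oze; first exact: lt_le_trans Bb0.
  have : {for zeta, continuous (fun z' : cplx R => p * tau z' - p * tau z)}.
    apply: (@continuous_add R (cplx R)); last exact: (@continuous_const R (cplx R)).
    by apply: (@continuous_mul R (cplx R)) => //; exact: (@continuous_const R (cplx R)).
  move=> cc; apply: (@continuous_comp (cplx R) R R _ (fun x : R => `|x|)) => //.
  exact: norm_continuous.
exists (cos (tau z)), (sin (tau z)), U; split.
- exact: cos2Dsin2.
- split; last first.
    split; last by rewrite /= subrr normr0.
    by split => //; rewrite /cdisk /= subrr cabs0; lra.
  rewrite openE => z' [[Oz' z'z] tz']; apply: filterI; first apply: filterI.
  + by apply: open_nbhs_nbhs; split => //; exact: open_plane_part.
  + by apply: open_nbhs_nbhs; split => //; exact: open_cdisk.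
  have ct := near_tau _ Oz' (inB _ z'z).
  have d0 : 0 < pi - `|p * tau z' - p * tau z| by rewrite subr_gt0.
  have := @continuous_lower R (cplx R) _ _ _ (@continuous_opp R (cplx R) _ _ ct) d0.
  by apply: filterS => y /=; lra.
- by move=> z' [[]].
- move=> zeta Oze zez nU.
  have zeB := inB _ zez.
  have far : pi <= `|p * tau zeta - p * tau z|.
    by rewrite leNgt; apply/negP => h; apply: nU.
  have d0 : (0 : R) < 1 by [].
  have := @continuous_lower R (cplx R) _ _ _ (near_tau _ Oze zeB) d0.
  apply: filterS => y /= y1 [[Oy yz] /= /ltW ty].
  (* no value lies between [1 / 2] and [pi], so a point outside [U] has a
     neighbourhood outside [U] *)
  have := gap y Oy (inB _ yz) ty; lra.
- move=> z' [[Oz' z'z] /= /ltW tz'].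
  have z'B := inB _ z'z.
  have [|zp _ zE] := polarE z Oz; first exact: lt_le_trans Bb0.
  have [|z'p _ z'E] := polarE z' Oz'; first exact: lt_le_trans Bb0.
  have -> : across (cos (tau z)) (sin (tau z)) z z' =
      cabs (z' - z0) * sin (tau z' - tau z).
    move: zE z'E; move: (cabs (z - z0)) (cabs (z' - z0)) (tau z) (tau z').
    move=> ro ro' t t' -> ->; rewrite /across /polar_point !mul1r !circleE.
    by rewrite !RepCx !ImpCx sinB; ring.
  have g := gap z' Oz' z'B tz'.
  have {}g : `|tau z' - tau z| <= 2 * C0 / p * B `^ p.
    move: g; rewrite -mulrBr normrM (gtr0_norm p0) => g.
    rewrite -(ler_pM2l p0); apply: le_trans g _.
    by rewrite le_eqVlt; apply/orP; left; apply/eqP; field; rewrite gt_eqF.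
  apply: le_trans Cw; rewrite -/B powRD; last by rewrite (gt_eqF B0) implybT.
  rewrite powRr1 ?(ltW B0)// mulrCA normrM ger0_norm ?cabs_ge0//.
  apply: ler_pM => //; first exact: cabs_ge0; first exact: ltW.
  exact: le_trans (normr_sin_le _) g.
Qed.

End CuspGeometry.

(** * Harmonic measure near and far from a cusp *)

Section Bump.
Context {R : realType}.

(** The truncation of [t] to the unit interval; absolute values make its
    continuity immediate. *)
Definition ramp (t : R) : R := (`|t| - `|t - 1| + 1) / 2.

Lemma ramp_ge0 t : 0 <= ramp t.
Proof. by rewrite /ramp; case: (ger0P t); case: (ger0P (t - 1)); lra. Qed.
Lemma ramp_le1 t : ramp t <= 1.
Proof. by rewrite /ramp; case: (ger0P t); case: (ger0P (t - 1)); lra. Qed.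
Lemma ramp0 t : t <= 0 -> ramp t = 0.
Proof. by rewrite /ramp; case: (ger0P t); case: (ger0P (t - 1)); lra. Qed.
Lemma ramp1 t : 1 <= t -> ramp t = 1.
Proof. by rewrite /ramp; case: (ger0P t); case: (ger0P (t - 1)); lra. Qed.

Definition bump (z0 : cplx R) (r1 r2 : R) (x : sphere R) : R :=
  if x is Some z then ramp ((r2 - cabs (z - z0)) / (r2 - r1)) else 0.

Lemma bump_ge0 z0 r1 r2 x : 0 <= bump z0 r1 r2 x.
Proof. by case: x => [z|] //=; exact: ramp_ge0. Qed.
Lemma bump_le1 z0 r1 r2 x : bump z0 r1 r2 x <= 1.
Proof. by case: x => [z|] //=; exact: ramp_le1. Qed.
Lemma bump_in z0 r1 r2 (z : cplx R) : r1 < r2 -> cabs (z - z0) <= r1 ->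
  bump z0 r1 r2 (Some z) = 1.
Proof. by move=> r12 zr /=; rewrite ramp1// ler_pdivlMr ?subr_gt0//; lra. Qed.
Lemma bump_out z0 r1 r2 (x : sphere R) : r1 < r2 -> coutside z0 r2 x ->
  bump z0 r1 r2 x = 0.
Proof.
move=> r12; case: x => [z|] //= zr; rewrite ramp0// ler_pdivrMr ?subr_gt0//; lra.
Qed.

Lemma continuous_bump z0 r1 r2 : r1 < r2 -> continuous (bump z0 r1 r2).
Proof.
move=> r12 [z|].
  suff : {for z, continuous (fun y : cplx R => bump z0 r1 r2 (Some y))} by [].
  have cn (f : cplx R -> R) : {for z, continuous f} ->
      {for z, continuous (fun y => `|f y|)}.
    move=> cf; apply: (@continuous_comp (cplx R) R R _ (fun x : R => `|x|)) => //.
    exact: norm_continuous.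
  have ct : {for z, continuous (fun y : cplx R => (r2 - cabs (y - z0)) / (r2 - r1))}.
    apply: (@continuous_mul R (cplx R)); last exact: (@continuous_const R (cplx R)).
    apply: (@continuous_add R (cplx R)); first exact: (@continuous_const R (cplx R)).
    exact/(@continuous_opp R (cplx R))/continuous_dist.
  rewrite /bump /ramp.
  apply: (@continuous_mul R (cplx R)); last exact: (@continuous_const R (cplx R)).
  apply: (@continuous_add R (cplx R)); last exact: (@continuous_const R (cplx R)).
  apply: (@continuous_add R (cplx R)); first exact: cn.
  apply: (@continuous_opp R (cplx R)); apply: cn.
  by apply: (@continuous_add R (cplx R)) => //; exact: (@continuous_const R (cplx R)).
move=> A nA; apply/nbhs_NoneP; split; first exact: (nbhs_singleton nA).
exists (`|r2| + cabs z0) => w wr /=; rewrite ramp0; first exact: (nbhs_singleton nA).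
rewrite ler_pdivrMr ?subr_gt0// mul0r.
have := cabsD (w - z0) z0; rewrite subrK; have := ler_norm r2; lra.
Qed.

End Bump.

Section HarmonicMeasure.
Context {R : realType}.
Variables (Omega : set (sphere R)) (omega : sphere R -> probability (sphere_borel R) R).
Hypotheses (oO : open Omega) (hm : is_harmonic_measure Omega omega).

Lemma measurable_open_sphere (A : set (sphere_borel R)) :
  @open (sphere R) A -> measurable A.
Proof. by move=> oA; exact: sub_sigma_algebra. Qed.

Lemma measurable_frontier : measurable (frontier Omega : set (sphere_borel R)).
Proof.
rewrite frontier_open//; apply: measurableD; last exact: measurable_open_sphere.
rewrite -[X in measurable X]setCK; apply: measurableC.
apply: measurable_open_sphere; exact/closed_openC/closed_closure.
Qed.

(** A member of the family is at most the Perron solution, which is the mean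
    of [phi] for a probability measure. So the uniform bound of the members
    costs no argument on subharmonic functions. *)
Lemma perron_member_le (phi : sphere R -> R) u (x : sphere R) : Omega x -> continuous phi ->
  (forall y, phi y <= 1) -> perron_family Omega phi u -> (u x <= 1%:E)%E.
Proof.
move=> Ox cphi phi1 pu; have [w1 wphi] := hm Ox.
have /wphi Ephi : {within frontier Omega, continuous phi}.
  exact: continuous_subspaceT.
apply: (@le_trans _ _ (perron Omega phi x)).
  by apply: ereal_sup_ubound; exists u.
rewrite -Ephi.
apply: (@le_trans _ _ (\int[omega x]_(y in frontier Omega) (cst 1%:E y))%E).
  by apply: le_integral_pointwise => y _; rewrite lee_fin.
rewrite integral_cst; last exact: measurable_frontier.
by rewrite mul1e le_eqVlt; apply/orP; left; apply/eqP; exact: w1.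
Qed.

(** Since [phi] dominates the indicator of [E], the Perron solution dominates
    the harmonic measure of [E]. *)
Lemma harmonic_measure_le (phi : sphere R -> R) (E : set (sphere_borel R))
    (x : sphere R) (eta : R) :
  Omega x -> continuous phi -> measurable E -> E `<=` frontier Omega ->
  (forall y, 0 <= phi y) -> (forall y, E y -> 1 <= phi y) ->
  (forall u, perron_family Omega phi u -> (u x <= eta%:E)%E) ->
  (omega x E <= eta%:E)%E.
Proof.
move=> Ox cphi mE EF phi0 phi1 u_eta; have [_ wphi] := hm Ox.
have /wphi Ephi : {within frontier Omega, continuous phi}.
  exact: continuous_subspaceT.
apply: (@le_trans _ _ (perron Omega phi x)); last first.
  by apply: ge_ereal_sup => _ [u pu <-]; exact: u_eta.
rewrite -Ephi -(setIidl EF) -integral_indic//; last exact: measurable_frontier.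
apply: le_integral_pointwise => y _; rewrite lee_fin indicE.
by case: (boolP (y \in E)) => [/set_mem|_] //; exact: phi1.
Qed.

Lemma perron_member_boundary (phi : sphere R -> R) u (x : sphere R) :
  perron_family Omega phi u -> frontier Omega x -> phi x = 0 ->
  forall e : R, 0 < e -> \forall y \near x, Omega y -> (u y <= e%:E)%E.
Proof.
move=> [_ bd] fx phix e e0.
have : (@limf_esup (sphere R) (sphere R) R u (within Omega (nbhs x)) < e%:E)%E.
  by apply: le_lt_trans (bd _ fx) _; rewrite phix lte_fin.
move=> /limf_esup_within_lt; apply: filterS => y h Oy; exact/ltW/h.
Qed.

(** Take boundary data equal to 1 on the disk of radius [r1] and to 0 beyond
    [r2]. By [strip_decay] from [r2] outwards, the members of the Perron
    family are at most [2 ^- k] on the ring from [s] to [s'], and by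
    [outer_decay] on all that lies beyond [s]. *)
Lemma harmonic_measure_far (z0 : cplx R) (r1 r2 s s' b w : R) (k : nat) :
  0 < r1 -> r1 < r2 -> 0 < w -> r2 + k%:R * (3 * w) <= s -> s < s' ->
  s' + k%:R * (3 * w) <= b -> strip_domain Omega z0 b w ->
  forall x, Omega x -> coutside z0 s x ->
    (omega x (frontier Omega `&` sdisk z0 r1) <= ((2 ^+ k)^-1)%:E)%E.
Proof.
move=> r10 r12 w0 r2s ss' s'b strip x Ox xs.
have kw : 0 <= k%:R * (3 * w) by rewrite mulr_ge0// mulr_ge0// ltW.
apply: (@harmonic_measure_le (bump z0 r1 r2)) => //.
- exact: continuous_bump.
- apply: measurableI; first exact: measurable_frontier.
  by apply: measurable_open_sphere; exact: open_sdisk.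
- exact: bump_ge0.
- by move=> y [_ [z zr1 <-]]; rewrite bump_in// ltW.
move=> u pu; have [su _] := pu.
have u1 y : Omega y -> (u y <= 1%:E)%E.
  move=> Oy; apply: perron_member_le pu => //; first exact: continuous_bump.
  exact: bump_le1.
have bd y : frontier Omega y -> coutside z0 r2 y -> forall e : R, 0 < e ->
    \forall y' \near y, Omega y' -> (u y' <= e%:E)%E.
  by move=> fy yr; apply: perron_member_boundary pu _ _ => //; exact: bump_out.
have eta0 : 0 <= (2 ^+ k)^-1 :> R by rewrite invr_ge0 exprn_ge0.
have s0 : 0 < s by lra.
apply: (@outer_decay _ Omega u z0 s s' _ oO su) => //.
- move=> z Oz /andP[zs zs'].
  apply: (@strip_decay _ Omega u z0 r2 b w) => //; try lra.
  by move=> zeta fz /andP[r2z _]; apply: bd => //=; exact: ltW.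
- move=> [y|] fy ys; apply: bd => //=; move: ys => /=; lra.
Qed.

(** The boundary data are now 0 on the disk of radius [r1] and 1 beyond [r2],
    and the decay is from [r1] inwards. *)
Lemma harmonic_measure_near (z0 : cplx R) (r1 r2 s w : R) (k : nat) :
  r1 < r2 -> 0 < w -> s + k%:R * (3 * w) <= r1 -> strip_domain Omega z0 r1 w ->
  forall z, Omega (Some z) -> cabs (z - z0) <= s ->
    (omega (Some z) (frontier Omega `\` sdisk z0 r2) <= ((2 ^+ k)^-1)%:E)%E.
Proof.
move=> r12 w0 sr1 strip z Oz zs.
have kw : 0 <= k%:R * (3 * w) by rewrite mulr_ge0// mulr_ge0// ltW.
pose phi x := 1 - bump z0 r1 r2 x.
have cphi : continuous phi.
  move=> x; apply: (@continuous_add R (sphere R)); first exact: continuous_const.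
  exact/(@continuous_opp R (sphere R))/continuous_bump.
apply: (@harmonic_measure_le phi) => //.
- apply: measurableD; first exact: measurable_frontier.
  by apply: measurable_open_sphere; exact: open_sdisk.
- by move=> y; rewrite subr_ge0 bump_le1.
- move=> y [_ yr]; rewrite /phi bump_out ?subr0//.
  case: y yr => [y|] //= yr; rewrite leNgt; apply/negP => h; apply: yr.
  by exists y.
move=> u pu; have [su _] := pu.
have u1 y : Omega y -> (u y <= 1%:E)%E.
  move=> Oy; apply: perron_member_le pu => // y'.
  by rewrite gerBl bump_ge0.
(* the boundary data vanish all the way to [z0]: there is no inner circle to
   stay away from, which a negative inner radius expresses *)
apply: (@strip_decay _ Omega u z0 (- (k%:R * (3 * w))) r1 w) => //; try lra.
  move=> zeta fz /andP[_ r1z]; apply: perron_member_boundary pu fz _.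
  by rewrite /phi bump_in ?subrr// ltW.
by rewrite addrC subrr cabs_ge0.
Qed.

Variable mu : {measure set (sphere_borel R) -> \bar R}.

Lemma measurable_part (z0 : cplx R) (s : R) :
  measurable (Omega `&` sdisk z0 s : set (sphere_borel R)).
Proof.
by apply: measurableI; apply: measurable_open_sphere => //; exact: open_sdisk.
Qed.

(** Points closer to [z0] than [s] contribute at most their mass. *)
Lemma balayage_le (E : set (sphere_borel R)) (z0 : cplx R) (s eta : R) : 0 <= eta ->
  (forall x, Omega x -> coutside z0 s x -> (omega x E <= eta%:E)%E) ->
  measurable E ->
  (balayage Omega omega mu E <= mu (Omega `&` sdisk z0 s) + eta%:E * mu Omega)%E.
Proof.
move=> eta0 far mE.
have mO : measurable (Omega : set (sphere_borel R)) by exact: measurable_open_sphere.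
have mS := @measurable_part z0 s.
apply: (@le_trans _ _ (\int[mu]_(x in Omega)
    ((\1_(Omega `&` sdisk z0 s) x)%:E + cst eta%:E x))%E).
  apply: le_integral_pointwise => x Ox; rewrite indicE.
  have [xs|xs] := boolP (x \in _).
    apply: le_trans (@probability_le1 _ _ _ (omega x) _ mE) _.
    by rewrite -EFinD lee_fin lerDl.
  rewrite add0e; apply: far => //.
  case: x Ox xs => [z|] //= Oz; rewrite notin_setE => zs.
  by rewrite leNgt; apply/negP => h; apply: zs; split => //; exists z.
rewrite ge0_integralD//.
- by rewrite integral_indic// integral_cst// setIAC setIid.
- by apply/measurable_EFinP; exact: measurable_indic.
Qed.

(** As [omega z] has total mass 1 on the frontier, what it does not give to
    the rest of the frontier it gives to [E]. *)
Lemma balayage_ge (E : set (sphere_borel R)) (z0 : cplx R) (s eta : R) : 0 <= eta <= 1 ->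
  (forall z, Omega (Some z) -> cabs (z - z0) < s ->
    (omega (Some z) (frontier Omega `\` E) <= eta%:E)%E) ->
  measurable E -> E `<=` frontier Omega ->
  ((1 - eta)%:E * mu (Omega `&` sdisk z0 s) <= balayage Omega omega mu E)%E.
Proof.
move=> /andP[eta0 eta1] near_z0 mE EF.
have mO : measurable (Omega : set (sphere_borel R)) by exact: measurable_open_sphere.
have mS := @measurable_part z0 s.
have -> : ((1 - eta)%:E * mu (Omega `&` sdisk z0 s) = \int[mu]_(x in Omega)
    ((1 - eta)%:E * (\1_(Omega `&` sdisk z0 s) x)%:E))%E.
  rewrite ge0_integralZl_EFin ?subr_ge0//.
    by rewrite integral_indic// setIAC setIid.
  by apply/measurable_EFinP; exact: measurable_indic.
apply: le_integral_pointwise => x Ox; rewrite indicE.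
have [xs|xs] := boolP (x \in _); last by rewrite mule0 measure_ge0.
rewrite mule1; move: (xs); rewrite inE => -[_ [z zs zx]].
rewrite -zx in Ox *; have [w1 _] := hm Ox.
have EE : (omega (Some z) (frontier Omega) =
    omega (Some z) E + omega (Some z) (frontier Omega `\` E))%E.
  rewrite -measureU//; last by rewrite setDE setICA setICr setI0.
    by rewrite setDUK.
  by apply: measurableD => //; exact: measurable_frontier.
have h := near_z0 z Ox zs.
have fE : omega (Some z) E \is a fin_num by exact: fin_num_measure.
move: EE h; rewrite w1 -(fineK fE) => EE h.
rewrite lee_fin lerBlDr -lee_fin EE EFinD.
exact: leeD2l.
Qed.

End HarmonicMeasure.

(** * Affine and tangent substitutions *)

Section Substitutions.
Context {R : realType}.
Local Notation mu := (@lebesgue_measure R).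
Local Open Scope ereal_scope.

Section Affine.
Variables (c y0 : R).
Hypothesis c0 : c != 0%R.

Let phi : measurableTypeR R -> measurableTypeR R := fun t => (y0 + c * t)%R.

Let mphi : measurable_fun setT phi.
Proof.
apply: continuous_measurable_fun => x; apply: (@continuous_add R R).
  exact: (@continuous_const R R).
by apply: (@continuous_mul R R); [exact: (@continuous_const R R)|exact: cvg_id].
Qed.

Let nc : {nonneg R} := NngNum (normr_ge0 c).

HB.instance Definition _ := isMeasurableFun.Build _ _ _ _ phi mphi.

(** By uniqueness of Lebesgue measure it is enough to check half-open
    intervals; a negative [c] exchanges their open and closed ends. *)
Lemma lebesgue_measure_affine (A : set (measurableTypeR R)) : measurable A ->
  mu A = `|c|%:E * pushforward mu phi A.
Proof.
move=> mA.
rewrite (@lebesgue_measure_unique R (mscale nc (pushforward mu phi)) _ A mA)//.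
move=> _ [[a b] _ <-].
rewrite -[RHS]/(`|c|%:E * mu (phi @^-1` `]a, b]%classic)).
have [ab|ba] := ltP a b; last first.
  have e : `]a, b]%classic = set0 :> set R by rewrite set_itv_ge// bnd_simp -leNgt.
  by rewrite !e preimage_set0 !measure0 mule0.
have [cp|cn] : (0 < c)%R \/ (c < 0)%R by move: c0; rewrite neq_lt => /orP[]; [right|left].
  have -> : phi @^-1` `]a, b] = `]((a - y0) / c)%R, ((b - y0) / c)%R]%classic.
    apply/seteqP; split => x /=; rewrite !in_itv /= /phi;
    by rewrite ltr_pdivrMr// ler_pdivlMr// => /andP[? ?]; apply/andP; split; lra.
  rewrite !lebesgue_measure_itv /= !lte_fin ltr_pM2r ?invr_gt0// ltrD2r ab.
  rewrite gtr0_norm// -!EFinD -EFinM; congr EFin.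
  by field; rewrite gt_eqF.
have -> : phi @^-1` `]a, b] = `[((b - y0) / c)%R, ((a - y0) / c)%R[%classic.
  apply/seteqP; split => x /=; rewrite !in_itv /= /phi;
  by rewrite ler_ndivrMr// ltr_ndivlMr// => /andP[? ?]; apply/andP; split; lra.
rewrite !lebesgue_measure_itv /= !lte_fin ltr_nM2r ?invr_lt0// ltrD2r ab.
rewrite ltr0_norm// -!EFinD -EFinM; congr EFin.
by field; rewrite lt_eqF.
Qed.

Lemma ge0_integral_affine (f : R -> \bar R) : measurable_fun setT f ->
  (forall x, 0 <= f x) ->
  \int[mu]_y f y = `|c|%:E * \int[mu]_t f (y0 + c * t)%R.
Proof.
move=> mf f0.
rewrite (eq_measure_integral (mscale nc (pushforward mu phi))); last first.
  by move=> A mA _; exact: lebesgue_measure_affine.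
rewrite ge0_integral_mscale//; congr (_ * _).
by rewrite ge0_integral_pushforward.
Qed.

End Affine.

(** The density of the angle with respect to the slope, its tangent. *)
Definition slope_density (t : R) : R := ((1 + t ^+ 2)^-1)%R.

Lemma continuous_slope_density : continuous slope_density.
Proof.
move=> t; apply: (@continuous_inv R R (fun t => 1 + t ^+ 2)%R).
  by rewrite gt_eqF// ltr_pwDl// sqr_ge0.
apply: (@continuous_add R R); first exact: (@continuous_const R R).
by apply: (@continuous_mul R R); exact: cvg_id.
Qed.

Lemma slope_density_ge0 t : (0 <= slope_density t)%R.
Proof. by rewrite invr_ge0 addr_ge0// sqr_ge0. Qed.

Definition slope_measure (A : set (measurableTypeR R)) : \bar R :=
  \int[mu]_(t in A) (slope_density t)%:E.

Lemma measurable_slope_density (D : set R) : measurable_fun D (EFin \o slope_density).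
Proof.
apply/measurable_EFinP; apply: measurable_funTS.
exact: continuous_measurable_fun continuous_slope_density.
Qed.

Let slope0 : slope_measure set0 = 0. Proof. exact: integral_set0. Qed.
Let slope_ge0 A : 0 <= slope_measure A.
Proof. by apply: integral_ge0 => x _; rewrite lee_fin slope_density_ge0. Qed.
Let slope_additive : semi_sigma_additive slope_measure.
Proof.
move=> F mF tF mUF; rewrite /slope_measure ge0_integral_bigcup//.
- by apply: is_cvg_ereal_nneg_natsum_cond => n _ _; exact: slope_ge0.
- exact: measurable_slope_density.
- by move=> x _; rewrite lee_fin slope_density_ge0.
Qed.
HB.instance Definition _ := isMeasure.Build _ _ _ slope_measure
  slope0 slope_ge0 slope_additive.

Definition half_turn : set (measurableTypeR R) := `](- (pi / 2))%R, (pi / 2)%R[%classic.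
Let mhalf : measurable half_turn. Proof. exact: measurable_itv. Qed.

(** On the half turn, where the cosine is positive, this is the tangent; the
    power of the cosine makes it visibly measurable on the whole line. *)
Let tanp : measurableTypeR R -> measurableTypeR R := fun t => (sin t * cos t `^ (-1))%R.
Let mtanp : measurable_fun setT tanp.
Proof.
apply: measurable_funM; first by apply: continuous_measurable_fun => ?; exact: continuous_sin.
apply: (measurableT_comp (measurable_powR (-1))).
by apply: continuous_measurable_fun => ?; exact: continuous_cos.
Qed.
HB.instance Definition _ := isMeasurableFun.Build _ _ _ _ tanp mtanp.

Let cos_half t : half_turn t -> (0 < cos t)%R.
Proof. by rewrite /half_turn /= in_itv /=; exact: cos_gt0_pihalf. Qed.

Let tanpE t : half_turn t -> tanp t = tan t.
Proof. by move=> /cos_half c0; rewrite /tanp powR_inv1// ltW. Qed.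

Let slope_itv (a b : R) : slope_measure `]a, b]%classic = mu `]atan a, atan b]%classic.
Proof.
have [ab|ba] := ltP a b; last first.
  have e (x y : R) : (y <= x)%R -> `]x, y]%classic = set0 :> set R.
    by move=> yx; rewrite set_itv_ge// bnd_simp -leNgt.
  by rewrite !e ?measure0//; exact: le_atan.
rewrite lebesgue_measure_itv /= lte_fin lt_atan// -EFinD /slope_measure.
rewrite integral_itv_obnd_cbnd; last exact: measurable_slope_density.
rewrite (@continuous_FTC2 _ _ (@atan R))//.
- by apply: continuous_subspaceT => x; exact: continuous_slope_density.
- split; first by move=> x _; exact: derivable_atan.
  + by apply: cvg_at_right_filter; exact: continuous_atan.
  + by apply: cvg_at_left_filter; exact: continuous_atan.
- by move=> x _; rewrite derive1_atan.
Qed.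

(** Both sides are measures in [B], and they agree on half-open intervals
    because [atan] is a primitive of [slope_density]. *)
Lemma slope_measure_tan (B : set (measurableTypeR R)) : measurable B ->
  slope_measure B = mu ([set t | B (tan t)] `&` half_turn).
Proof.
move=> mB.
transitivity (pushforward (mrestr mu mhalf) tanp B); last first.
  rewrite /pushforward /mrestr; congr (mu _); apply/seteqP; split => t /= [Bt ht];
  by split => //; move: Bt; rewrite tanpE.
apply: (@measure_unique _ R (measurableTypeR R) (@ocitv R)
  (fun n => `](- n%:R)%R, n%:R%R]%classic : set R) _ _ _ _ slope_measure
  (pushforward (mrestr mu mhalf) tanp)) => //.
- exact: ocitvI.
- by move=> i; exact: is_ocitv.
- exact: bigcup_itvT.
- move=> _ [[a b] _ <-]; rewrite [LHS](slope_itv a b).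
  rewrite -[RHS]/(mu (tanp @^-1` `]a, b]%classic `&` half_turn)); congr (mu _).
  apply/seteqP; split => t /=.
    rewrite !in_itv /= => /andP[at_ tb].
    have ht : half_turn t.
      rewrite /half_turn /= in_itv /= (lt_trans (atan_gtNpi2 a) at_).
      exact: le_lt_trans tb (atan_ltpi2 b).
    split => //; rewrite tanpE// -[a]atanK -[b]atanK.
    have hx (x : R) : atan x \in `](- (pi / 2))%R, (pi / 2)%R[.
      by rewrite in_itv /= atan_gtNpi2 atan_ltpi2.
    rewrite ltr_tan ?hx// at_ /=.
    by move: tb; rewrite le_eqVlt => /orP[/eqP ->//|tb]; rewrite ltW// ltr_tan ?hx.
  move=> [/[swap] ht]; rewrite tanpE// !in_itv /= => /andP[at_ tb].
  rewrite -[t]tanK// lt_atan//=; exact: le_atan.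
- move=> n; rewrite [ltLHS](slope_itv (- n%:R)%R n%:R%R) lebesgue_measure_itv /=.
  by case: ifP => // _; rewrite -EFinD ltry.
Qed.

End Substitutions.

(** * Polar coordinates along lines *)

Section Polar.
Context {R : realType}.
Local Notation mu := (@lebesgue_measure R).
Local Notation T := (measurableTypeR R).
Local Open Scope ereal_scope.

Section Formula.
Variables (x0 y0 : R) (phi : R -> R) (A : set (T * T)).
Hypotheses (mA : measurable A) (mphi : measurable_fun setT phi)
  (phi0 : forall r, (0 <= phi r)%R).

Definition dist0 (q : T * T) : R := Num.sqrt ((q.1 - x0) ^+ 2 + (q.2 - y0) ^+ 2).

Definition ray (r t : R) : T * T := (x0 + r * cos t, y0 + r * sin t)%R.

Let f : T * T -> \bar R := (fun q => (phi (dist0 q))%:E) \_ A.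

Let f0 q : 0 <= f q.
Proof. by rewrite /f /patch; case: ifP => // _; rewrite lee_fin. Qed.

Let fE q : f q = (phi (dist0 q) * \1_A q)%:E.
Proof. by rewrite /f /patch indicE; case: ifP; rewrite ?mulr1 ?mulr0. Qed.

Lemma measurable_sqrt : measurable_fun setT (@Num.sqrt R).
Proof. by apply: continuous_measurable_fun => x; exact: sqrt_continuous. Qed.

Let mdist : measurable_fun setT dist0.
Proof.
apply: (measurableT_comp measurable_sqrt).
apply: measurable_funD; apply: measurable_funX; apply: measurable_funB => //.
Qed.

Let mf : measurable_fun setT f.
Proof.
rewrite (_ : f = EFin \o (fun q => phi (dist0 q) * \1_A q)%R); last first.
  by apply/funext => q; rewrite fE.
apply/measurable_EFinP; apply: measurable_funM; first exact: measurableT_comp.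
exact: measurable_indic.
Qed.

(** The integrand once [y] is replaced with the slope [t], that is [y = y0 +
    (x - x0) * t]. *)
Let F1 (q : T * T) : \bar R := `|q.1 - x0|%:E * f (q.1, y0 + (q.1 - x0) * q.2)%R.

Let mF1 : measurable_fun setT F1.
Proof.
apply: emeasurable_funM.
  apply/measurable_EFinP; apply: measurableT_comp => //.
  exact: measurable_funB.
apply: (measurableT_comp mf); apply: measurable_fun_pair => //=.
apply: measurable_funD => //; apply: measurable_funM => //.
exact: measurable_funB.
Qed.

Let F10 q : 0 <= F1 q.
Proof. by rewrite mule_ge0// lee_fin. Qed.

Let inner_slope x : x != x0 ->
  \int[mu]_y f (x, y) = \int[mu]_t F1 (x, t).
Proof.
move=> xx0; have xx : (x - x0 != 0)%R by rewrite subr_eq0.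
rewrite (ge0_integral_affine y0 xx)//; last exact: measurableT_comp.
rewrite /F1 /= ge0_integralZl_EFin//.
by apply: (measurableT_comp mf); apply: measurable_fun_pair.
Qed.

(** The integrand once [x] is moreover replaced with the signed distance [r],
    that is [x = x0 + r * cos (atan t)]; the Jacobian [|x - x0| * cos (atan
    t)] has become [|r| * slope_density t], since [cos (atan t) ^+ 2] is
    [slope_density t]. *)
Let F2 (q : T * T) : \bar R :=
  (slope_density q.1 * `|q.2|)%:E * f (ray q.2 (atan q.1)).

Let matan : measurable_fun setT (@atan R : T -> T).
Proof. by apply: continuous_measurable_fun => x; exact: continuous_atan. Qed.
Let mcos : measurable_fun setT (@cos R : T -> T).
Proof. by apply: continuous_measurable_fun => x; exact: continuous_cos. Qed.
Let msin : measurable_fun setT (@sin R : T -> T).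
Proof. by apply: continuous_measurable_fun => x; exact: continuous_sin. Qed.

Let mray : measurable_fun setT (fun q : T * T => ray q.2 (atan q.1)).
Proof.
apply: measurable_fun_pair => /=; apply: measurable_funD => //;
  apply: measurable_funM => //; do 2 apply: measurableT_comp => //.
Qed.

Let mF2 : measurable_fun setT F2.
Proof.
apply: emeasurable_funM; last exact: (measurableT_comp mf mray).
apply/measurable_EFinP; apply: measurable_funM.
  apply: measurableT_comp => //.
  by apply: continuous_measurable_fun; exact: continuous_slope_density.
exact: measurableT_comp.
Qed.

Let F20 q : 0 <= F2 q.
Proof. by rewrite mule_ge0// lee_fin mulr_ge0// slope_density_ge0. Qed.

Let inner_ray t : \int[mu]_x F1 (x, t) = \int[mu]_r F2 (t, r).
Proof.
have c0 : (0 < cos (atan t))%R.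
  by rewrite cos_atan invr_gt0 sqrtr_gt0 ltr_pwDl// sqr_ge0.
have ct : (cos (atan t) * t = sin (atan t))%R.
  by rewrite -[X in (_ * X = _)%R](atanK t) /tan mulrC divfK// gt_eqF.
have cc : slope_density t = (cos (atan t) * cos (atan t))%R.
  rewrite /slope_density cos_atan -expr2 exprVn sqr_sqrtr//.
  by rewrite addr_ge0// sqr_ge0.
rewrite (ge0_integral_affine x0 (lt0r_neq0 c0))//; last exact: measurableT_comp.
rewrite -ge0_integralZl_EFin//; last first.
  by apply: (measurableT_comp mF1); apply: measurable_fun_pair.
apply: eq_integral => r _; rewrite /F1 /F2 /ray /= muleA -EFinM; congr (_%:E * f (_, _)).
- by rewrite cc addrAC subrr add0r normrM (gtr0_norm c0) mulrA.
- by rewrite mulrC.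
- by rewrite addrAC subrr add0r -ct mulrAC mulrC.
Qed.

(** Here a point of the plane is given by a direction in a half turn and a
    signed distance [r]. *)
Definition sector (r : R) : \bar R :=
  (`|r| * phi `|r|)%:E * mu ([set t | A (ray r t)] `&` half_turn).

Let dist_ray r t : dist0 (ray r t) = `|r|%R.
Proof.
rewrite /dist0 /ray /= !(addrAC _ (_ * _)%R) !subrr !add0r !exprMn -mulrDr.
by rewrite cos2Dsin2 mulr1 sqrtr_sqr.
Qed.

Let ray_section r : \int[mu]_t F2 (t, r) = sector r.
Proof.
pose B := [set t : T | A (ray r (atan t))].
have mB : measurable B.
  have mr : measurable_fun setT (fun t : T => ray r (atan t)).
    apply: measurable_fun_pair => /=; apply: measurable_funD => //;
    by apply: measurable_funM => //; apply: measurableT_comp.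
  by have := mr measurableT _ mA; rewrite setTI.
transitivity (\int[mu]_(t in B) ((`|r| * phi `|r|)%:E * (slope_density t)%:E)).
  rewrite [RHS]integral_mkcond; apply: eq_integral => t _.
  rewrite /F2 /= fE dist_ray -EFinM /patch indicE.
  rewrite (_ : (ray r (atan t) \in A) = (t \in B)); last first.
    by apply/idP/idP; rewrite !inE.
  case: ifP => _; last by rewrite !mulr0.
  by rewrite -EFinM mulr1; congr EFin; ring.
rewrite ge0_integralZl_EFin//; last 3 first.
- by move=> t _; rewrite lee_fin slope_density_ge0.
- exact: measurable_slope_density.
- by rewrite mulr_ge0.
rewrite /sector -[X in _ * X]/(slope_measure B) slope_measure_tan//.
congr (_ * mu _); apply/seteqP; split => t [Bt ht]; split => //; move: Bt;
  by rewrite /B /= tanK// in_itv.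
Qed.

(** Polar coordinates by two changes of variable on lines, each followed by an
    exchange of integrals: first the slope replaces the ordinate on each
    vertical line, then the signed distance to the centre replaces the
    abscissa on each line through the centre. The slope is turned into an
    angle by [slope_measure_tan]. *)
Lemma integral_sectors :
  \int[mu \x mu]_(q in A) (phi (dist0 q))%:E = \int[mu]_r sector r.
Proof.
rewrite integral_mkcond -/f fubini_tonelli1//.
transitivity (\int[mu]_x \int[mu]_t F1 (x, t)).
  have m1 : measurable_fun setT (fun x => \int[mu]_y f (x, y)).
    exact: measurable_fun_fubini_tonelli_F.
  have m2 : measurable_fun setT (fun x => \int[mu]_t F1 (x, t)).
    exact: measurable_fun_fubini_tonelli_F.
  have mD : measurable ([set: T] `\ x0) by exact: measurableD.
  rewrite -[LHS](integral_setD1 mD (measurable_funTS m1)).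
  rewrite -[RHS](integral_setD1 mD (measurable_funTS m2)).
  by apply: eq_integral => x; rewrite inE => -[_ /eqP xx]; exact: inner_slope.
rewrite fubini_tonelli//.
under eq_integral do rewrite inner_ray.
by rewrite fubini_tonelli//; apply: eq_integral => r _; exact: ray_section.
Qed.

Lemma measurable_sector : measurable_fun setT sector.
Proof.
rewrite (_ : sector = fun r => \int[mu]_t F2 (t, r)).
  exact: (measurable_fun_fubini_tonelli_G F2).
by apply/funext => r; rewrite ray_section.
Qed.

End Formula.
End Polar.

(** * Full turns and open sets of the plane *)

Section FullTurn.
Context {R : realType}.
Local Notation mu := (@lebesgue_measure R).
Local Notation T := (measurableTypeR R).

Lemma lebesgue_measure_translate (c : R) (A : set T) : measurable A ->
  mu [set t : T | A (t + c)] = mu A.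
Proof.
move=> mA; rewrite [RHS](@lebesgue_measure_affine R 1 c (oner_neq0 R) A mA).
rewrite normr1 mul1e; congr (mu _); apply/seteqP; split => t /=;
by rewrite mul1r addrC.
Qed.

Lemma measure_itv_split (S : set T) (a b c : R) : measurable S -> a <= b -> b <= c ->
  (mu (S `&` `[a, c[%classic) = mu (S `&` `[a, b[%classic) + mu (S `&` `[b, c[%classic))%E.
Proof.
move=> mS ab bc; rewrite -measureU; [|exact: measurableI|exact: measurableI|].
- congr (mu _); rewrite -setIUr; congr (_ `&` _); apply/seteqP.
  split => t /=; rewrite !in_itv /=.
    by move=> /andP[at_ tc]; have [tb|tb] := ltP t b; [left; rewrite at_|right].
  by move=> [/andP[at_ tb]|/andP[bt tc]]; apply/andP; split => //; lra.
- apply/seteqP; split => // t [[_ /=]]; rewrite in_itv /= => /andP[_ tb] [_ /=].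
  by rewrite in_itv /= => /andP[bt _]; move: tb; rewrite ltNge bt.
Qed.

Lemma measure_itv_open (S : set T) (a b : R) : measurable S ->
  mu (S `&` `]a, b[%classic) = mu (S `&` `[a, b[%classic).
Proof.
move=> mS; have [ab|ba] := ltP a b; last first.
  by rewrite !set_itv_ge ?bnd_simp -?leNgt -?ltNge//.
have -> : `[a, b[%classic = a |` `]a, b[%classic :> set R.
  by rewrite setU1itv// bnd_simp.
have m1 : measurable (S `&` `]a, b[%classic) by exact: measurableI.
have m2 : measurable (S `&` [set a]) by exact: measurableI.
have m0 : mu (S `&` [set a]) = 0%E.
  apply/eqP; rewrite eq_le measure_ge0 andbT.
  by rewrite -(@lebesgue_measure_set1 R a); apply: le_measure; rewrite ?inE.
by rewrite setIUr setUC measureU0.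
Qed.

(** The half turn and its translate by [pi] cover the angles from [- pi / 2]
    to [3 / 2 * pi]; periodicity moves those below 0 to the end of the turn.
    *)
Lemma measure_full_turn (S : set T) : measurable S ->
  (forall t, S (t + 2 * pi) <-> S t) ->
  (mu (S `&` half_turn) + mu ([set t | S (t + pi)%R] `&` half_turn) =
   mu (S `&` `[0%R, (2 * pi)%R[%classic))%E.
Proof.
move=> mS per; have pi0 := pi_gt0 R.
have -> : [set t : T | S (t + pi)] `&` half_turn =
    [set t : T | (S `&` `](pi / 2), (3 / 2 * pi)[%classic) (t + pi)].
  apply/seteqP; split => t /= [St]; rewrite /half_turn /= !in_itv /= => /andP[? ?];
  by split => //; apply/andP; split; lra.
rewrite lebesgue_measure_translate; last exact: measurableI.
have -> : S `&` half_turn = S `&` `](- (pi / 2)), (pi / 2)[%classic by [].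
rewrite !measure_itv_open// (@measure_itv_split S (- (pi / 2)) 0)//; [|lra|lra].
have -> : mu (S `&` `[(- (pi / 2))%R, 0%R[%classic) =
    mu (S `&` `[(3 / 2 * pi)%R, (2 * pi)%R[%classic).
  rewrite -(@lebesgue_measure_translate (2 * pi)
    (S `&` `[(3 / 2 * pi), (2 * pi)[%classic)); last exact: measurableI.
  congr (mu _); apply/seteqP; split => t /= [/per St]; rewrite !in_itv /= => /andP[? ?];
  by split => //; apply/andP; split; lra.
rewrite (@measure_itv_split S 0 (pi / 2) (2 * pi))//; [|lra|lra].
rewrite (@measure_itv_split S (pi / 2) (3 / 2 * pi) (2 * pi))//; [|lra|lra].
by rewrite -addeA addeC -addeA.
Qed.

(** An open set is a countable union of boxes with rational data, and boxes
    are measurable rectangles. *)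
Lemma open_plane_measurable (A : set (T * T)) : @open (R * R)%type A -> measurable A.
Proof.
move=> oA.
pose box (p : rat * rat * rat) : set (T * T) :=
  `](ratr p.1.1 - ratr p.2), (ratr p.1.1 + ratr p.2)[%classic `*`
  `](ratr p.1.2 - ratr p.2), (ratr p.1.2 + ratr p.2)[%classic.
have -> : A = \bigcup_(p in [set p | box p `<=` A]) box p.
  apply/seteqP; split => [q Aq|q [p pA]]; last exact: pA.
  have /nbhs_ballP[e /= e0 eA] : nbhs q A by exact: open_nbhs_nbhs.
  have [k /andP[]] : exists k : rat, 0 < (ratr k : R) < e / 2.
    have e20 : 0 < e / 2 by lra.
    have [k] := rat_in_itvoo e20.
    by rewrite in_itv /= => h; exists k.
  move=> k0 ke.
  have near_rat (x : R) : exists a : rat, `|x - ratr a| < ratr k.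
    have xk : x - ratr k < x + ratr k by lra.
    have [a] := rat_in_itvoo xk.
    rewrite in_itv /= => /andP[? ?]; exists a.
    by rewrite ltr_norml; apply/andP; split; lra.
  have [a1 ha1] := near_rat q.1; have [a2 ha2] := near_rat q.2.
  move: ha1 ha2; rewrite !ltr_norml => /andP[? ?] /andP[? ?].
  exists (a1, a2, k); last first.
    by split; rewrite /= in_itv /=; apply/andP; split; lra.
  move=> y [/=]; rewrite !in_itv /= => /andP[? ?] /andP[? ?]; apply: eA.
  by split; rewrite /ball /= ltr_norml; apply/andP; split; lra.
rewrite bigcup_mkcond; apply: countable_bigcupT_measurable; first exact: countableP.
move=> p; case: ifP => // _; apply: measurableX; exact: measurable_itv.
Qed.
End FullTurn.

(** * The power weight in polar coordinates *)

Section PowerWeight.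
Context {R : realType}.
Local Notation mu := (@lebesgue_measure R).
Local Notation T := (measurableTypeR R).

Definition arc (Omega : set (sphere R)) (z0 : cplx R) (r : R) : set T :=
  [set t : R | 0 <= t < 2 * pi /\ Omega (Some (polar_point z0 1 r t))].

(** The ray of negative distance [- r] in the direction [t] is the ray of
    distance [r] in the direction [t + pi]; so folding the negative half-line
    onto the positive one joins two half turns into a full one. *)
Lemma integral_sectors_full_turn (x0 y0 : R) (phi : R -> R) (A : set (T * T)) :
  measurable A -> measurable_fun setT phi -> (forall r, 0 <= phi r) ->
  (\int[mu]_r sector x0 y0 phi A r = \int[mu]_(r in `]0%R, +oo[)
     ((r * phi r)%:E * mu ([set t | A (ray x0 y0 r t)] `&` `[0%R, (2 * pi)%R[%classic)))%E.
Proof.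
move=> mA mphi phi0; set H := sector x0 y0 phi A.
have mH : measurable_fun setT H by exact: measurable_sector.
have H0 r : (0 <= H r)%E by rewrite mule_ge0// lee_fin mulr_ge0.
pose P := H \_ `]0%R, +oo[%classic; pose N := H \_ `]-oo, 0%R[%classic.
have mP : measurable_fun setT P.
  by apply/(measurable_restrictT H); [exact: measurable_itv|exact: measurable_funTS].
have mN : measurable_fun setT N.
  by apply/(measurable_restrictT H); [exact: measurable_itv|exact: measurable_funTS].
have P0 r : (0 <= P r)%E by rewrite /P /patch; case: ifP.
have N0 r : (0 <= N r)%E by rewrite /N /patch; case: ifP.
have HPN r : H r = (P r + N r)%E.
  rewrite /P /N /patch; case: ifPn; rewrite ?inE ?notin_setE /= ?in_itv /= ?andbT => h1;
  case: ifPn; rewrite ?inE ?notin_setE /= ?in_itv /= ?andbT => h2;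
  rewrite ?adde0 ?add0e//; first by exfalso; lra.
  have -> : r = 0 by lra.
  by rewrite /H /sector normr0 mul0r mul0e.
transitivity (\int[mu]_r (P r + N r))%E; first by apply: eq_integral => r _; exact: HPN.
rewrite ge0_integralD//.
have n10 : -1 != 0 :> R by rewrite oppr_eq0 oner_neq0.
rewrite [X in (_ + X)%E](ge0_integral_affine 0 n10)// normrN1 mul1e.
have mopp : measurable_fun setT (fun t : T => (0 + -1 * t : T)).
  by apply: measurable_funD => //; exact: measurable_funM.
rewrite -ge0_integralD//; last exact: (measurableT_comp mN mopp).
rewrite [RHS]integral_mkcond; apply: eq_integral => r _.
rewrite /P /N /patch add0r mulN1r.
have -> : (- r \in `]-oo, 0%R[%classic) = (r \in `]0%R, +oo[%classic).
  by apply/idP/idP; rewrite !inE /= !in_itv /= ?andbT oppr_lt0.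
case: ifPn; last by rewrite adde0.
rewrite inE /= in_itv /= andbT => r0.
rewrite /H /sector normrN gtr0_norm// -ge0_muleDr//; congr (_ * _)%E.
have mS : measurable [set t : T | A (ray x0 y0 r t)].
  have mr : measurable_fun setT (fun t : T => ray x0 y0 r t : T * T).
    apply: measurable_fun_pair => /=; apply: measurable_funD => //;
    apply: measurable_funM => //; apply: continuous_measurable_fun => x.
      exact: continuous_cos.
    exact: continuous_sin.
  by have := mr measurableT _ mA; rewrite setTI.
have := measure_full_turn mS; rewrite /half_turn => <- //; last first.
  move=> t /=; rewrite /ray.
  by rewrite (_ : 2 * pi = pi *+ 2 :> R) ?mulr_natl// cosD2pi sinD2pi.
congr (_ + mu _)%E; apply/seteqP; split => t /= [At ht]; split => //; move: At;
  by rewrite /ray cosDpi sinDpi !mulrN !mulNr.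
Qed.

Lemma measurable_plane_preimage (E : set (sphere R)) : open E ->
  measurable ((fun q : R * R => Some (Cx q.1 q.2)) @^-1` E : set (T * T)).
Proof.
move=> oE; apply: open_plane_measurable.
apply: (@open_comp (R * R)%type (sphere R)) => // q _.
apply: (@continuous_comp (R * R)%type (cplx R) (sphere R) (fun q => Cx q.1 q.2) Some).
  exact: continuous_Cx.
exact: one_point_compactification_some_continuous.
Qed.

Lemma power_weight_polar (Omega : set (sphere R)) (z0 : cplx R) (b s : R) :
  open Omega -> 0 < s ->
  (power_weight z0 b (Omega `&` sdisk z0 s) =
   \int[mu]_(r in `]0%R, s[) ((r * r `^ (2 * b - 2))%:E * mu (arc Omega z0 r)))%E.
Proof.
move=> oO s0; pose x0 := Rep z0; pose y0 := Imp z0.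
pose A : set (T * T) := (fun q : R * R => Some (Cx q.1 q.2)) @^-1` (Omega `&` sdisk z0 s).
pose phi (r : R) := r `^ (2 * b - 2).
have mA : measurable A.
  by apply: measurable_plane_preimage; apply: openI => //; exact: open_sdisk.
transitivity (\int[(mu \x mu)%E]_(q in A) (phi (dist0 x0 y0 q))%:E)%E.
  apply: eq_integral => q _; congr (phi _)%:E.
  by rewrite (CxE z0).
have mphi : measurable_fun setT phi by exact: measurable_powR.
have phi0 r : 0 <= phi r by exact: powR_ge0.
rewrite (integral_sectors x0 y0 mA mphi phi0).
rewrite (integral_sectors_full_turn x0 y0 mA mphi phi0).
rewrite integral_mkcond [RHS]integral_mkcond; apply: eq_integral => r _.
rewrite /patch; have [r0|r0] := ltP 0 r; last first.
  by rewrite !memNset//= in_itv /= ltNge r0.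
rewrite mem_set; last by rewrite /= in_itv /= r0.
have rayE t : Cx (ray x0 y0 r t).1 (ray x0 y0 r t).2 = polar_point z0 1 r t.
  by rewrite /polar_point mul1r circleE.
have rayr t : cabs (polar_point z0 1 r t - z0) = r.
  by rewrite /polar_point mul1r addrAC subrr add0r cabsM cabs_expi mulr1 cabs_real gtr0_norm.
have [rs|rs] := ltP r s.
  rewrite mem_set; last by rewrite /= in_itv /= r0.
  congr (_ * mu _)%E; apply/seteqP; split => t /=; rewrite /A /= rayE in_itv /=.
    by move=> [[Oz _] t2].
  move=> [t2 Oz]; split => //; split => //; exists (polar_point z0 1 r t) => //.
  by rewrite /cdisk /= rayr.
rewrite memNset; last by rewrite /= in_itv /= r0 /= ltNge rs.
rewrite (_ : _ `&` _ = set0) ?measure0 ?mule0//.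
apply/seteqP; split => // t /= [[_ [z zs [zE]]] _].
by move: zs; rewrite zE rayE /cdisk /= rayr ltNge rs.
Qed.

End PowerWeight.

(** * Integrals and smallness of powers *)

Section Powers.
Context {R : realType}.
Local Notation mu := (@lebesgue_measure R).

Lemma integral_FTC_powR (c x y : R) : 0 < c -> 0 < x -> x < y ->
  (\int[mu]_(r in `[x, y]) (r `^ (c - 1))%:E = ((y `^ c - x `^ c) / c)%:E)%E.
Proof.
move=> c0 x0 xy.
have dF (r : R) : 0 < r -> is_derive r (1 : R) (c^-1 *: (@powR R ^~ c)) (r `^ (c - 1)).
  move=> r0; have := is_deriveZ c^-1 (is_derive1_powR c r0).
  by rewrite /GRing.scale /= mulrA mulVf ?gt_eqF// mul1r.
have cF (r : R) : 0 < r -> {for r, continuous (c^-1 *: (@powR R ^~ c))}.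
  move=> r0; apply: differentiable_continuous; apply/derivable1_diffP.
  by have [] := dF r r0.
have cf : {within `[x, y], continuous (fun r : R => r `^ (c - 1))}.
  apply: continuous_in_subspaceT => r; rewrite inE /= in_itv /= => /andP[xr _].
  have r0 : 0 < r by exact: lt_le_trans xr.
  apply: differentiable_continuous; apply/derivable1_diffP.
  by have [] := is_derive1_powR (c - 1) r0.
rewrite (@continuous_FTC2 _ _ (c^-1 *: (@powR R ^~ c)) _ _ xy cf).
- by rewrite -EFinB /GRing.scale /= -mulrBr mulrC.
- split.
  + move=> r; rewrite in_itv /= => /andP[xr _].
    by have [] := dF r (lt_trans x0 xr).
  + by apply: cvg_at_right_filter; exact: cF.
  + by apply: cvg_at_left_filter; apply: cF; exact: lt_trans xy.
- move=> r; rewrite in_itv /= => /andP[xr _].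
  by rewrite derive1E; have [_] := dF r (lt_trans x0 xr).
Qed.

(** The integrand may be unbounded at 0: the integral is the increasing limit
    of the integrals from [s / n.+2] to [s]. *)
Lemma integral0_powR (c s : R) : 0 < c -> 0 < s ->
  (\int[mu]_(r in `]0%R, s[) (r `^ (c - 1))%:E = (s `^ c / c)%:E)%E.
Proof.
move=> c0 s0.
have mp (D : set R) : measurable_fun D (fun r : R => (r `^ (c - 1))%:E).
  by apply/measurable_EFinP/measurable_funTS; exact: measurable_powR.
pose x n : R := s / n.+2%:R.
have x0 n : 0 < x n by rewrite divr_gt0.
have xs n : x n < s by rewrite ltr_pdivrMr// ltr_pMr// ltr1n.
pose F n : set R := `[x n, s]%classic.
have FE : \bigcup_n F n = `]0%R, s]%classic.
  apply/seteqP; split => [r [n _]|r]; rewrite /F /= !in_itv /=.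
    by move=> /andP[xr ->]; rewrite (lt_le_trans (x0 n) xr).
  move=> /andP[r0 rs]; exists (Num.bound (s / r)) => //=.
  rewrite in_itv /= rs andbT ler_pdivrMr// mulrC -ler_pdivrMr//.
  apply: ltW; apply: lt_trans (archi_boundP _) _; first by rewrite divr_ge0 ?ltW.
  by rewrite ltr_nat ltnS.
rewrite integral_itv_bndo_bndc// -FE.
have ndF : nondecreasing_seq F.
  move=> n m nm; apply/subsetPset => r; rewrite /F /= !in_itv /= => /andP[xr ->].
  rewrite andbT; apply: le_trans xr; rewrite /x ler_pM2l// lef_pV2 ?posrE//.
  by rewrite ler_nat !ltnS.
have cvI : (\int[mu]_(r in F n) (r `^ (c - 1))%:E @[n --> \oo] -->
    \int[mu]_(r in \bigcup_n F n) (r `^ (c - 1))%:E)%E.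
  apply: ge0_nondecreasing_set_cvg_integral.
  - exact: ndF.
  - by move=> n; exact: measurable_itv.
  - by move=> n; exact: mp.
  - by move=> n r _; rewrite lee_fin powR_ge0.
rewrite -(cvg_lim _ cvI)//; apply/cvg_lim => //.
have -> : (fun n => \int[mu]_(r in F n) (r `^ (c - 1))%:E)%E =
    (fun n => ((s `^ c - x n `^ c) / c)%:E).
  by apply/funext => n; rewrite integral_FTC_powR.
apply: cvg_EFin; first by near=> n.
have cx : x n @[n --> \oo] --> (0 : R)^'+.
  move=> A /nbhs_right0_ex[r1 r10 Ar]; exists (Num.bound (s / r1)) => // n /= Nn.
  apply: Ar; rewrite x0 /= ltr_pdivrMr// mulrC -ltr_pdivrMr//.
  apply: lt_le_trans (archi_boundP _) _; first by rewrite divr_ge0// ltW.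
  by rewrite ler_nat (leq_trans Nn)// -addn2 leq_addr.
have cxc := cvg_comp _ _ cx (powR_cvg0 c0).
rewrite -[X in _ --> X / c]subr0.
by apply: cvgMl; apply: cvgB => //; exact: cvg_cst.
Unshelve. all: by end_near. Qed.

(** Take the [m]-th power of [n / m < (n %/ m).+1 <= 2 ^+ (n %/ m)], with a
    real quotient on the left. *)
Lemma pow2_ge_poly (n m : nat) : (0 < m)%N -> (n%:R / m%:R) ^+ m <= 2 ^+ n :> R.
Proof.
move=> m0; have mR : 0 < m%:R :> R by rewrite ltr0n.
apply: (@le_trans _ _ ((2 ^+ (n %/ m)) ^+ m)).
  rewrite lerXn2r ?nnegrE ?divr_ge0 ?exprn_ge0//.
  rewrite ler_pdivrMr// -natrX -natrM ler_nat.
  apply: (@leq_trans ((n %/ m).+1 * m)); first by rewrite ltnW// ltn_ceil.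
  by rewrite leq_mul2r; apply/orP; right; exact: ltn_expl.
by rewrite -exprM ler_weXn2l ?ler1n// leq_trunc_div.
Qed.

Lemma powR_small (q e : R) : 0 < q -> 0 < e ->
  \forall r \near (0 : R)^'+, r `^ q <= e.
Proof.
move=> q0 e0; have /cvgrPdist_le /(_ e e0) := powR_cvg0 q0.
by apply: filterS => r; rewrite sub0r normrN ger0_norm ?powR_ge0.
Qed.

(** As [k.+1] is at least [kappa * r `^ - p], the inequality [pow2_ge_poly]
    with an [m] larger than [N / p] bounds [2 ^- k] by a constant times [r `^
    (p * m)]. *)
Lemma superpolynomial (kappa p N e : R) : 0 < kappa -> 0 < p -> 0 < N -> 0 < e ->
  \forall r \near (0 : R)^'+, forall k : nat, kappa <= k.+1%:R * r `^ p ->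
    (2 ^+ k)^-1 <= e * r `^ N.
Proof.
move=> ka0 p0 N0 e0.
pose m := (Num.bound (N / p)).+1.
have mp : N < p * m%:R.
  rewrite mulrC -ltr_pdivrMr//; apply: lt_le_trans (archi_boundP _) _.
    by rewrite divr_ge0 ?ltW.
  by rewrite ler_nat.
pose M : R := 2 * (m%:R / kappa) ^+ m.
have m0 : 0 < m%:R :> R by rewrite ltr0n.
have M0 : 0 < M by rewrite mulr_gt0// exprn_gt0// divr_gt0.
have q0 : 0 < p * m%:R - N by lra.
have h := powR_small q0 (divr_gt0 e0 M0).
near=> r => k hk; have r0 : 0 < r by [].
have rM : r `^ (p * m%:R - N) <= e / M by near: r.
have rp0 : 0 < r `^ p by rewrite powR_gt0.
have k0 : 0 < k.+1%:R :> R by rewrite ltr0n.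
have step : (2 ^+ k)^-1 <= M * (r `^ p) ^+ m.
  have h1 : (2 ^+ k)^-1 = 2 * (2 ^+ k.+1)^-1 :> R.
    by rewrite exprS invfM mulrA divff ?mul1r// pnatr_eq0.
  rewrite h1 /M -mulrA ler_pM2l// -exprMn.
  have h2 := @pow2_ge_poly k.+1 m isT.
  apply: (@le_trans _ _ ((k.+1%:R / m%:R) ^+ m)^-1).
    by rewrite lef_pV2 ?posrE ?exprn_gt0 ?divr_gt0.
  rewrite -exprVn lerXn2r ?nnegrE ?invr_ge0 ?mulr_ge0 ?invr_ge0//;
    rewrite ?(ltW ka0) ?(ltW rp0) ?(ltW k0)//.
  rewrite invf_div mulrAC -mulrA ler_pM2l//.
  by rewrite ler_pdivlMr// mulrC ler_pdivrMr// mulrC.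
apply: le_trans step _; rewrite -powR_mulrn ?powR_ge0// -powRrM.
rewrite (_ : p * m%:R = (p * m%:R - N) + N); last by ring.
rewrite powRD; last by rewrite (gt_eqF r0) implybT.
by rewrite mulrA ler_wpM2r ?powR_ge0// mulrC -ler_pdivlMr.
Unshelve. all: by end_near. Qed.

End Powers.

(** * The mass of the weight near a cusp *)

Section MassNearCusp.
Context {R : realType}.
Local Notation mu := (@lebesgue_measure R).

(** [fine] sends an infinite measure to 0, so a positive angular width is the
    measure itself. *)
Lemma arc_measure (Omega : set (sphere R)) (z0 : cplx R) (r : R) :
  0 < angular_width Omega z0 r ->
  mu (arc Omega z0 r) = (angular_width Omega z0 r)%:E.
Proof.
rewrite /angular_width -/(arc Omega z0 r).
by case: (mu (arc Omega z0 r)) => [x| |] //=; rewrite ltxx.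
Qed.

(** The error [K * r `^ (2 * d + p)] is at most [e * r `^ d] for small [r]; so
    the width is between [(a - e) * r `^ d] and [(a + e) * r `^ d], and in
    polar coordinates there remain integrals of powers. *)
Lemma power_weight_bounds (Omega : set (sphere R)) (z0 : cplx R) (d a b p K : R) :
  open Omega -> 0 < d -> 0 < a -> 0 < b -> 0 < p ->
  (\forall r \near (0 : R)^'+,
      `|angular_width Omega z0 r - a * r `^ d| <= K * r `^ (2 * d + p)) ->
  forall e, 0 < e < a -> exists2 rho : R, 0 < rho & forall s, 0 < s < rho ->
    (((a - e) * (s `^ (2 * b + d) / (2 * b + d)))%:E
      <= power_weight z0 b (Omega `&` sdisk z0 s)
      <= ((a + e) * (s `^ (2 * b + d) / (2 * b + d)))%:E)%E.
Proof.
move=> oO d0 a0 b0 p0 hw e /andP[e0 ea].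
have K10 : 0 < `|K| + 1 by rewrite ltr_wpDl.
have : \forall r \near (0 : R)^'+, (a - e) * r `^ d <= angular_width Omega z0 r
    <= (a + e) * r `^ d.
  have dp0 : 0 < d + p by rewrite addr_gt0.
  have eK : 0 < e / (`|K| + 1) by rewrite divr_gt0.
  have h2 := powR_small dp0 eK.
  near=> r; have r0 : 0 < r by [].
  have h1 : `|angular_width Omega z0 r - a * r `^ d| <= K * r `^ (2 * d + p).
    by near: r.
  have h3 : r `^ (d + p) <= e / (`|K| + 1) by near: r.
  have rd0 : 0 < r `^ d by rewrite powR_gt0.
  have : K * r `^ (2 * d + p) <= e * r `^ d.
    rewrite (_ : 2 * d + p = (d + p) + d); last by ring.
    rewrite powRD; last by rewrite (gt_eqF r0) implybT.
    rewrite mulrA ler_pM2r//.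
    apply: (@le_trans _ _ ((`|K| + 1) * r `^ (d + p))).
      by rewrite ler_wpM2r ?powR_ge0//; have := ler_norm K; lra.
    by rewrite mulrC -ler_pdivlMr.
  move: h1; rewrite ler_norml => /andP[? ?] ?.
  by rewrite !mulrDl mulNr; apply/andP; split; lra.
move=> /nbhs_right0_ex[rho rho0 hrho]; exists rho => // s /andP[s0 srho].
have c0 : 0 < 2 * b + d by lra.
have rlt r : 0 < r -> r < s -> 0 < r < rho by move=> -> rs; exact: lt_trans srho.
rewrite power_weight_polar//.
have arcE r : 0 < r < s -> mu (arc Omega z0 r) = (angular_width Omega z0 r)%:E.
  move=> /andP[r0 rs]; apply: arc_measure.
  have /andP[+ _] := hrho r (rlt r r0 rs).
  by apply: lt_le_trans; rewrite mulr_gt0 ?powR_gt0//; lra.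
have powE r k : 0 < r -> r * r `^ (2 * b - 2) * (k * r `^ d) = k * r `^ (2 * b + d - 1).
  move=> r0; rewrite mulrCA; congr (_ * _).
  rewrite -[X in X * _ * _]powRr1 ?(ltW r0)//.
  rewrite -!powRD ?(gt_eqF r0) ?implybT//; congr (_ `^ _); ring.
have mpow (D : set R) : measurable_fun D (fun r : R => (r `^ (2 * b + d - 1))%:E).
  by apply/measurable_EFinP/measurable_funTS; exact: measurable_powR.
have scaled k : 0 <= k -> (\int[mu]_(r in `]0%R, s[) (k%:E * (r `^ (2 * b + d - 1))%:E) =
    (k * (s `^ (2 * b + d) / (2 * b + d)))%:E)%E.
  move=> k0; rewrite ge0_integralZl_EFin//.
  - by rewrite integral0_powR.
  - by move=> r _; rewrite lee_fin powR_ge0.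
  - exact: mpow.
apply/andP; split.
  rewrite -scaled; last lra.
  apply: le_integral_pointwise => r; rewrite /= in_itv /= => /andP[r0 rs].
  rewrite arcE ?r0// -!EFinM lee_fin -powE// ler_wpM2l ?mulr_ge0 ?powR_ge0 ?(ltW r0)//.
  by have /andP[+ _] := hrho r (rlt r r0 rs).
rewrite -scaled; last lra.
apply: le_integral_pointwise => r; rewrite /= in_itv /= => /andP[r0 rs].
rewrite arcE ?r0// -!EFinM lee_fin -powE// ler_wpM2l ?mulr_ge0 ?powR_ge0 ?(ltW r0)//.
by have /andP[_ +] := hrho r (rlt r r0 rs).
Unshelve. all: by end_near. Qed.

End MassNearCusp.

(** * Localization of the balayage *)

Section Balayage.
Context {R : realType}.
Variables (Omega : set (sphere R)) (z0 : cplx R).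
Variables (omega : sphere R -> probability (sphere_borel R) R)
  (mu : {measure set (sphere_borel R) -> \bar R}).
Hypotheses (oO : open Omega) (hm : is_harmonic_measure Omega omega).

Let nu (r : R) := balayage Omega omega mu (frontier Omega `&` sdisk z0 r).

(** In the disk of radius [2 * r] the domain is a strip of half-width [w] of
    order [r `^ (1 + p)]. Bumps and rings are placed at the radii [r * (1 + j
    * e)] with [j] from [-2] to [4]; each interval between successive radii
    has length [e * r] and accommodates [k] moves of length [3 * w], with [k]
    of order [r `^ - p], so [eta = 2 ^- k] is smaller than any power of [r].
    *)
Lemma balayage_sandwich (p e N : R) : has_cusp_exponent Omega z0 p ->
  0 < e <= 1 / 4 -> 0 < N ->
  exists2 rho : R, 0 < rho & forall r, 0 < r < rho -> exists eta : R,
    [/\ 0 <= eta <= e, eta <= e * r `^ N,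
     (nu r <= mu (Omega `&` sdisk z0 (r * (1 + 2 * e))) + eta%:E * mu Omega)%E &
     ((1 - eta)%:E * mu (Omega `&` sdisk z0 (r * (1 - 2 * e))) <= nu r)%E].
Proof.
move=> hc /andP[e0 e4] N0; have p0 : 0 < p by case: hc.
have [C [b0 [C0 b00 strip]]] := cusp_strip oO hc.
(* with [w = D * r `^ (1 + p)], the condition [C * x `^ (1 + p) <= w] of
   [cusp_strip] holds for all [x <= 8 * r] *)
pose D := C * 8 `^ (1 + p).
have D0 : 0 < D by rewrite mulr_gt0// powR_gt0.
have D30 : 0 < (3 * D)^-1 by rewrite invr_gt0 mulr_gt0.
have ka0 : 0 < e / (3 * D) by rewrite divr_gt0// mulr_gt0.
have h1 := powR_small p0 D30.
have h2 := superpolynomial ka0 p0 N0 e0.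
have h3 := powR_small N0 (@ltr01 R).
apply: nbhs_right0_ex; near=> r; have r0 : 0 < r by [].
have rp : r `^ p <= (3 * D)^-1 by near: r.
have rN : r `^ N <= 1 by near: r.
have rb : r <= b0 / 8 by near: r; apply: nbhs_right_le; rewrite divr_gt0.
have superp : forall k : nat, e / (3 * D) <= k.+1%:R * r `^ p ->
    (2 ^+ k)^-1 <= e * r `^ N by near: r.
pose w := D * (r * r `^ p).
have rp0 : 0 < r `^ p by rewrite powR_gt0.
have w0 : 0 < w by rewrite mulr_gt0// mulr_gt0.
have w3 : 3 * w <= r.
  have : 3 * D * r `^ p <= 1 by rewrite mulrC -ler_pdivlMr ?mulr_gt0// div1r.
  by rewrite /w => h; have := ler_wpM2l (ltW r0) h; lra.
have wE x : 0 <= x <= 8 * r -> C * x `^ (1 + p) <= w.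
  move=> /andP[x0 x8]; rewrite /w /D -mulrA ler_pM2l//.
  have -> : r * r `^ p = r `^ (1 + p).
    by rewrite powRD ?(gt_eqF r0) ?implybT// powRr1 ?ltW.
  by rewrite -powRM ?(ltW r0)// ge0_ler_powR ?nnegrE ?mulr_ge0 ?(ltW r0)//; lra.
have stripw x : 0 < x -> x <= 2 * r -> strip_domain Omega z0 x w.
  move=> xpos x2 z; apply: strip => //; first by lra.
  by apply: wE; apply/andP; split; lra.
have i1 : r < r * (1 + e) by rewrite ltr_pMr// ltrDl.
have i2 : r * (1 + 2 * e) < r * (1 + 3 * e) by rewrite ltr_pM2l//; lra.
have i3 : 0 < r * (1 + 4 * e) by rewrite mulr_gt0//; lra.
have i4 : r * (1 + 4 * e) <= 2 * r by rewrite mulrC ler_pM2r//; lra.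
have i5 : r * (1 - e) < r by rewrite gtr_pMr// gtrBl.
have i7 : r * (1 - e) <= 2 * r by lra.
have i6 : 0 < r * (1 - e) by rewrite mulr_gt0//; lra.
pose k := Num.truncn (e * r / (3 * w)).
have w30 : 0 < 3 * w by rewrite mulr_gt0.
have /andP[klo khi] : k%:R <= e * r / (3 * w) < k.+1%:R.
  by apply: truncn_itv; rewrite divr_ge0 ?mulr_ge0// ltW.
have kw : k%:R * (3 * w) <= e * r by rewrite -ler_pdivlMr.
have kw0 : 0 <= k%:R * (3 * w) by rewrite mulr_ge0// ltW.
have j1 : r * (1 + e) + k%:R * (3 * w) <= r * (1 + 2 * e) by lra.
have j2 : r * (1 + 3 * e) + k%:R * (3 * w) <= r * (1 + 4 * e) by lra.
have j3 : r * (1 - 2 * e) + k%:R * (3 * w) <= r * (1 - e) by lra.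
have er0 : 0 < e * r by rewrite mulr_gt0.
have er4 : e * r <= r / 4 by have := ler_wpM2r (ltW r0) e4; lra.
have eta_small : (2 ^+ k)^-1 <= e * r `^ N.
  apply: superp; apply: ltW.
  apply: le_lt_trans (_ : _ <= e * r / (3 * w) * r `^ p) _; last by rewrite ltr_pM2r.
  rewrite le_eqVlt; apply/orP; left; apply/eqP; rewrite /w; field.
  by rewrite !gt_eqF.
exists (2 ^+ k)^-1; split => //.
- rewrite invr_ge0 exprn_ge0//=; apply: le_trans eta_small _.
  by rewrite ler_piMr// ltW.
- apply: (balayage_le oO); first by rewrite invr_ge0 exprn_ge0.
  + exact: (harmonic_measure_far oO hm r0 i1 w0 j1 i2 j2 (stripw _ i3 i4)).
  + by apply: measurableI; [exact: measurable_frontier|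
      apply: measurable_open_sphere; exact: open_sdisk].
- apply: (balayage_ge oO hm); [| | |exact: subIsetl].
  + rewrite invr_ge0 exprn_ge0//=; apply: le_trans eta_small _.
    by apply: le_trans (_ : e * 1 <= _); [rewrite ler_pM2l|lra].
  + move=> z Oz zr.
    rewrite (_ : _ `\` _ = frontier Omega `\` sdisk z0 r); last by rewrite setDIr setDv set0U.
    exact: (harmonic_measure_near oO hm i5 w0 j3 (stripw _ i6 i7) Oz (ltW zr)).
  + by apply: measurableI; [exact: measurable_frontier|
      apply: measurable_open_sphere; exact: open_sdisk].
Unshelve. all: by end_near. Qed.

End Balayage.

(** * The asymptotics of the balayage *)

Section Bounds.
Context {R : realType}.
Variables (Omega : set (sphere R)) (z0 : cplx R) (d a b : R).
Variables (omega : sphere R -> probability (sphere_borel R) R)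
  (mu : {measure set (sphere_borel R) -> \bar R}).
Hypotheses (oO : open Omega) (hm : is_harmonic_measure Omega omega)
  (hcusp : has_cusp Omega z0 d a) (b0 : 0 < b) (mufin : (mu Omega < +oo)%E).

Let nu (r : R) := balayage Omega omega mu (frontier Omega `&` sdisk z0 r).
Let N : R := 2 * b + d.
Let M : R := fine (mu Omega).

(** The coefficients of [r `^ N] in the bounds of the balayage, for a measure
    between [c1] and [c2] times the weight; at [e = 0] they are [c2 * a / N]
    and [c1 * a / N]. *)
Definition upper_factor (c2 e : R) : R :=
  c2 * ((a + e) * ((1 + 2 * e) `^ N / N)) + e * M.
Definition lower_factor (c1 e : R) : R :=
  (1 - e) * (c1 * ((a - e) * ((1 - 2 * e) `^ N / N))).

Lemma mu_finE : mu Omega = M%:E.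
Proof. by rewrite fineK// ge0_fin_numE. Qed.

(** The powers [(1 + 2 * e) `^ N] and [(1 - 2 * e) `^ N] come from the two
    radii of [balayage_sandwich], and the term [e * M] from the part of [mu]
    far from the cusp. *)
Lemma balayage_bounds (e c1 c2 rho1 : R) : 0 < e <= 1 / 4 -> e < a -> 0 <= c1 -> 0 <= c2 ->
  0 < rho1 ->
  (forall s, 0 < s < rho1 ->
    (c1%:E * power_weight z0 b (Omega `&` sdisk z0 s) <= mu (Omega `&` sdisk z0 s)
      <= c2%:E * power_weight z0 b (Omega `&` sdisk z0 s))%E) ->
  exists2 rho : R, 0 < rho & forall r, 0 < r < rho ->
    ((lower_factor c1 e * r `^ N)%:E <= nu r <= (upper_factor c2 e * r `^ N)%:E)%E.
Proof.
move=> /andP[e0 e4] ea c10 c20 rho10 hmu.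
have [d0 a0 [p [hc [K hw]]]] := hcusp.
have p0 : 0 < p by case: hc.
have N0 : 0 < N by rewrite addr_gt0// mulr_gt0.
have [|rho2 rho20 hpw] := power_weight_bounds oO d0 a0 b0 p0 hw (e := e).
  by rewrite e0.
have [|rho3 rho30 hnu] := balayage_sandwich mu oO hm hc (e := e) _ N0.
  by rewrite e0.
exists (Num.min (rho1 / 2) (Num.min (rho2 / 2) rho3)).
  by rewrite !lt_min rho30 !divr_gt0.
move=> r /andP[r0]; rewrite !lt_min => /and3P[r1 r2 r3].
have [|eta [/andP[eta0 etae] etaN hi lo]] := hnu r; first by rewrite r0.
have sup0 : 0 < r * (1 + 2 * e) by rewrite mulr_gt0//; lra.
have slo0 : 0 < r * (1 - 2 * e) by rewrite mulr_gt0//; lra.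
have supr : r * (1 + 2 * e) <= 2 * r by rewrite mulrC ler_pM2r//; lra.
have slor : r * (1 - 2 * e) <= r by rewrite ger_pMr//; lra.
clear hnu.
have powE x : 0 <= x -> (r * x) `^ N = r `^ N * x `^ N by move=> xge0; rewrite powRM// ltW.
have lo1 : 0 < r * (1 - 2 * e) < rho1 by rewrite slo0 /=; lra.
have lo2 : 0 < r * (1 - 2 * e) < rho2 by rewrite slo0 /=; lra.
have up1 : 0 < r * (1 + 2 * e) < rho1 by rewrite sup0 /=; lra.
have up2 : 0 < r * (1 + 2 * e) < rho2 by rewrite sup0 /=; lra.
apply/andP; split.
  apply: le_trans lo.
  have /andP[m1 _] := hmu _ lo1; have /andP[w1 _] := hpw _ lo2.
  apply: (@le_trans _ _ ((1 - e)%:E * (c1%:E *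
    ((a - e) * ((r * (1 - 2 * e)) `^ N / N))%:E))%E).
    rewrite -!EFinM lee_fin powE; last lra.
    by rewrite /lower_factor le_eqVlt; apply/orP; left; apply/eqP; ring.
  apply: lee_pmul => //.
  - by rewrite lee_fin; lra.
  - by rewrite -EFinM lee_fin mulr_ge0// mulr_ge0 ?divr_ge0 ?powR_ge0 ?(ltW N0)//; lra.
  - by rewrite lee_fin; lra.
  - by apply: le_trans m1; apply: lee_wpmul2l; rewrite ?lee_fin.
apply: le_trans hi _.
have /andP[_ m2] := hmu _ up1; have /andP[_ w2] := hpw _ up2.
apply: (@le_trans _ _ (c2%:E * ((a + e) * ((r * (1 + 2 * e)) `^ N / N))%:E
    + (e * r `^ N)%:E * M%:E)%E).
  apply: leeD.
    by apply: le_trans m2 _; apply: lee_wpmul2l; rewrite ?lee_fin.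
  rewrite mu_finE -!EFinM lee_fin ler_wpM2r//.
  by rewrite /M fine_ge0.
rewrite -!EFinM -EFinD lee_fin powE; last lra.
by rewrite /upper_factor le_eqVlt; apply/orP; left; apply/eqP; ring.
Qed.

Lemma continuous_powR_affine (k : R) :
  {for 0, continuous (fun e : R => (1 + k * e) `^ N)}.
Proof.
have cp : {for 1, continuous (@powR R ^~ N)}.
  apply: differentiable_continuous; apply/derivable1_diffP.
  by have [] := is_derive1_powR N (@ltr01 R).
apply: (@continuous_comp R R R (fun e : R => 1 + k * e) (@powR R ^~ N)).
  apply: (@continuous_add R R); first exact: (@continuous_const R R).
  by apply: (@continuous_mul R R); [exact: (@continuous_const R R)|exact: cvg_id].
by rewrite mulr0 addr0.
Qed.

Lemma upper_factor_cvg : upper_factor (1 + e) e @[e --> (0 : R)^'+] --> a / N.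
Proof.
have cid : {for (0 : R), continuous (fun e : R => e)} by exact: cvg_id.
have ck (k : R) : {for (0 : R), continuous (fun _ : R => k)} by exact: cvg_cst.
have ca (k : R) : {for (0 : R), continuous (fun e : R => k + e)}.
  by apply: (@continuous_add R R).
have cf : {for (0 : R), continuous (fun e : R => upper_factor (1 + e) e)}.
  rewrite /upper_factor; apply: (@continuous_add R R); apply: (@continuous_mul R R) => //.
  apply: (@continuous_mul R R) => //; apply: (@continuous_mul R R) => //.
  exact: continuous_powR_affine.
have -> : a / N = upper_factor (1 + 0) 0.
  by rewrite /upper_factor mulr0 !addr0 powR1 mul0r addr0 !mul1r.
exact: cvg_at_right_filter cf.
Qed.

Lemma lower_factor_cvg : lower_factor (1 - e) e @[e --> (0 : R)^'+] --> a / N.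
Proof.
have cid : {for (0 : R), continuous (fun e : R => e)} by exact: cvg_id.
have ck (k : R) : {for (0 : R), continuous (fun _ : R => k)} by exact: cvg_cst.
have ca (k : R) : {for (0 : R), continuous (fun e : R => k - e)}.
  by apply: (@continuous_add R R) => //; exact: (@continuous_opp R R).
have cpow : {for (0 : R), continuous (fun e : R => (1 - 2 * e) `^ N)}.
  rewrite (_ : (fun e : R => (1 - 2 * e) `^ N) = (fun e => (1 + (- 2) * e) `^ N)).
    exact: continuous_powR_affine.
  by apply/funext => e; rewrite mulNr.
have cf : {for (0 : R), continuous (fun e : R => lower_factor (1 - e) e)}.
  rewrite /lower_factor; apply: (@continuous_mul R R) => //.
  apply: (@continuous_mul R R) => //; apply: (@continuous_mul R R) => //.
  exact: (@continuous_mul R R).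
have -> : a / N = lower_factor (1 - 0) 0.
  by rewrite /lower_factor mulr0 !subr0 powR1 !mul1r.
exact: cvg_at_right_filter cf.
Qed.

(** By [power_weight_bounds] the weight of a small disk is finite, so that the
    bound of the absolute value splits into two inequalities. *)
Lemma sim_power_weight_bounds (e : R) : 0 < e -> e < a ->
  sim_power_weight Omega mu z0 b ->
  exists2 rho1 : R, 0 < rho1 & forall s, 0 < s < rho1 ->
    ((1 - e)%:E * power_weight z0 b (Omega `&` sdisk z0 s) <= mu (Omega `&` sdisk z0 s)
      <= (1 + e)%:E * power_weight z0 b (Omega `&` sdisk z0 s))%E.
Proof.
move=> e0 ea /(_ e e0)[rho rho0 hsim].
have [d0 a0 [p [hc [K hw]]]] := hcusp.
have p0 : 0 < p by case: hc.
have [|rho2 rho20 hpw] := power_weight_bounds oO d0 a0 b0 p0 hw (e := e).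
  by rewrite e0.
exists (Num.min rho rho2); first by rewrite lt_min rho0.
move=> s /andP[s0]; rewrite lt_min => /andP[s1 s2].
have s02 : 0 < s < rho2 by rewrite s0.
have /andP[w1 w2] := hpw _ s02.
have [x pwE] : exists x : R, power_weight z0 b (Omega `&` sdisk z0 s) = x%:E.
  move: w1 w2; case: (power_weight _ _ _) => [x| |] //=.
  by exists x.
have mA : measurable (Omega `&` sdisk z0 s : set (sphere_borel R)).
  exact: measurable_part.
have := hsim _ mA; rewrite pwE.
have sub : Omega `&` sdisk z0 s `<=` Omega `&` sdisk z0 rho.
  apply: setIS => y [z zs <-]; exists z => //.
  by apply: lt_trans zs s1.
move=> /(_ sub); case: (mu _) => [y| |] //=.
rewrite -?EFinD -?EFinM ?lee_fin ler_norml => /andP[? ?].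
by apply/andP; split; lra.
Qed.

Lemma balayage_fin_num (r : R) : nu r \is a fin_num.
Proof.
rewrite ge0_fin_numE; last by apply: integral_ge0 => x _; exact: measure_ge0.
apply: le_lt_trans (_ : _ <= \int[mu]_(x in Omega) (cst 1%:E x))%E _.
  apply: le_integral_pointwise => x _; apply: probability_le1.
  by apply: measurableI; [exact: measurable_frontier|
    apply: measurable_open_sphere; exact: open_sdisk].
by rewrite integral_cst ?mul1e//; exact: measurable_open_sphere.
Qed.

End Bounds.

Unset Implicit Arguments.

Theorem theorem2p1 (R : realType) (Omega : set (sphere R)) (z0 : cplx R)
    (d a b : R) (omega : sphere R -> probability (sphere_borel R) R)
    (mu : {measure set (sphere_borel R) -> \bar R})
    (Omega_domain : finitely_connected_jordan_domain Omega)
    (Omega_cusp : has_cusp Omega z0 d a)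
    (omega_harmonic : is_harmonic_measure Omega omega)
    (mu_finite : (mu Omega < +oo)%E)
    (nu_defined : balayage_defined Omega omega)
    (b_gt0 : 0 < b) :
  let nu := balayage Omega omega mu in
  (sim_power_weight Omega mu z0 b ->
    exists2 h : R -> R, h @ 0^'+ --> (0 : R) &
      \forall r \near 0^'+,
        nu (frontier Omega `&` sdisk z0 r) =
          ((1 + h r) * (a / (2 * b + d)) * r `^ (2 * b + d))%:E) /\
  (asymp_power_weight Omega mu z0 b ->
    exists r0 c1 c2 : R, [/\ 0 < r0, 0 < c1, 0 < c2 &
      forall r : R, 0 < r < r0 ->
        ((c1 * r `^ (2 * b + d))%:E <= nu (frontier Omega `&` sdisk z0 r) <=
         (c2 * r `^ (2 * b + d))%:E)%E]).
Proof.
move=> nu; have [oO _ _] := Omega_domain; have [d0 a0 _] := Omega_cusp.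
have N0 : 0 < 2 * b + d by rewrite addr_gt0// mulr_gt0.
pose N := 2 * b + d; pose G := a / N.
have G0 : 0 < G by rewrite divr_gt0.
split.
  move=> hsim.
  pose f r := fine (nu (frontier Omega `&` sdisk z0 r)).
  have fE r : nu (frontier Omega `&` sdisk z0 r) = (f r)%:E.
    by rewrite fineK//; exact: balayage_fin_num.
  (* the equation determines [h], and it remains to find its limit *)
  exists (fun r => f r / (G * r `^ N) - 1); last first.
    near=> r; have r0 : 0 < r by [].
    have GN : G * r `^ N != 0 by rewrite gt_eqF// mulr_gt0// powR_gt0.
    by rewrite fE addrC subrK -mulrA -/N -/G divfK.
  apply/cvgrPdist_le => del del0.
  have Gd : 0 < G * del by rewrite mulr_gt0.
  have [e [e0 e4 ea up lo]] : exists e : R, [/\ 0 < e, e <= 1 / 4, e < a,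
      upper_factor Omega d a b mu (1 + e) e <= G * (1 + del) &
      G * (1 - del) <= lower_factor d a b (1 - e) e].
    apply: (@filter_ex _ ((0 : R)^'+)).
    have /cvgrPdist_le /(_ _ Gd) u1 :
        upper_factor Omega d a b mu (1 + e) e @[e --> (0 : R)^'+] --> G.
      exact: upper_factor_cvg.
    have /cvgrPdist_le /(_ _ Gd) l1 :
        lower_factor d a b (1 - e) e @[e --> (0 : R)^'+] --> G.
      exact: lower_factor_cvg.
    near=> e.
    have uu : `|G - upper_factor Omega d a b mu (1 + e) e| <= G * del by near: e.
    have ll : `|G - lower_factor d a b (1 - e) e| <= G * del by near: e.
    have e4 : e <= 1 / 4 by near: e; apply: nbhs_right_le.
    have ea : e < a by near: e; exact: nbhs_right_lt.
    move: uu ll; rewrite !ler_norml => /andP[? ?] /andP[? ?].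
    by split => //; lra.
  have [rho1 rho10 hmu] := sim_power_weight_bounds oO Omega_cusp b_gt0 e0 ea hsim.
  have c10 : 0 <= 1 - e by lra.
  have c20 : 0 <= 1 + e by lra.
  have e04 : 0 < e <= 1 / 4 by rewrite e0.
  have [rho rho0 bnd] := balayage_bounds oO omega_harmonic Omega_cusp b_gt0 mu_finite
    e04 ea c10 c20 rho10 hmu.
  near=> r; have r0 : 0 < r by [].
  have rrho : 0 < r < rho by rewrite r0 /=; near: r; apply: nbhs_right_lt.
  have /andP[] := bnd r rrho; rewrite -/nu fE !lee_fin -/N => lof upf.
  have rN : 0 < r `^ N by rewrite powR_gt0.
  have GN : 0 < G * r `^ N by rewrite mulr_gt0.
  rewrite sub0r normrN ler_norml lerBrDr lerBlDr ler_pdivlMr// ler_pdivrMr//.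
  apply/andP; split.
    apply: le_trans lof; rewrite mulrCA mulrA ler_pM2r//.
    by have := lo; lra.
  apply: le_trans upf _; rewrite mulrCA mulrA ler_pM2r//.
  by have := up; lra.
move=> [rho [c1 [c2 [rho0 c10 c20 hasymp]]]].
(* for a two-sided bound one fixed admissible [e] is enough *)
pose e := Num.min (1 / 4) (a / 2).
have e0 : 0 < e by rewrite lt_min !divr_gt0.
have e4 : e <= 1 / 4 by rewrite ge_min; apply/orP; left.
have ea : e < a by rewrite gt_min; apply/orP; right; rewrite ltr_pdivrMr// ltr_pMr// ltr1n.
have hmu s : 0 < s < rho ->
    (c1%:E * power_weight z0 b (Omega `&` sdisk z0 s) <= mu (Omega `&` sdisk z0 s)
      <= c2%:E * power_weight z0 b (Omega `&` sdisk z0 s))%E.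
  move=> /andP[s0 sr]; apply: hasymp; first exact: measurable_part.
  apply: setIS => y [z zs <-]; exists z => //.
  by apply: lt_trans zs sr.
have e04 : 0 < e <= 1 / 4 by rewrite e0.
have [r0 r00 bnd] := balayage_bounds oO omega_harmonic Omega_cusp b_gt0 mu_finite
    e04 ea (ltW c10) (ltW c20) rho0 hmu.
have [f1 f2 f3] : [/\ 0 < 1 - e, 0 < a - e & 0 < 1 - 2 * e] by split; lra.
have [g1 g2] : 0 < a + e /\ 0 < 1 + 2 * e by split; lra.
have q (x : R) : 0 < x -> 0 < x `^ (2 * b + d) / (2 * b + d).
  by move=> x0; rewrite divr_gt0// powR_gt0.
exists r0, (lower_factor d a b c1 e), (upper_factor Omega d a b mu c2 e); split => //.
- by rewrite mulr_gt0// mulr_gt0// mulr_gt0// q.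
- rewrite ltr_pwDl//; first by rewrite mulr_gt0// mulr_gt0// q.
  by rewrite mulr_ge0 ?(ltW e0)// fine_ge0.
Unshelve. all: by end_near. Qed.
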